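(* Let $\lambda>0$ and let $\mathcal H$ be a homogeneous Poisson point process on $\mathbb H^+=\mathbb R\times\mathbb R^+$ with intensity $dt\otimes 2\lambda\,dh$ (the head point process of unit-speed stations), with law $\mathbb P$ on the canonical space of point configurations on $\mathbb H^+$, shift $\theta_s(\sum_i\delta_{(T_i,H_i)})=\sum_i\delta_{(T_i-s,H_i)}$, and let $\mathbb P^0_{\mathcal V}$ be the Palm probability of the handover point process $\mathcal V$. Then for every measurable $f\ge0$, $$\mathbb E^0_{\mathcal V}[f(\mathcal H)]=\pi\lambda^{3/2}\int_{(\mathbb R^+)^3}\mathbb E\Big[\mathbf 1_{\{\mathcal H(U^{\hat s}_{\hat h})=0\}}\,f\big(\theta_{\hat s}(\mathcal H+\delta_{(0,h)}+\delta_{(-t',h')})\big)\Big]\,dt'\,dh'\,dh,$$ where $\hat s=\hat s(0,h,-t',h')$ and $\hat h=\hat h(0,h,-t',h')$.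
   Context: To a head $(t_0,h_0)\in\mathbb H^+$ associate the radial bird $C_{(t_0,h_0)}=\{(t,((t-t_0)^2+h_0^2)^{1/2}):t\in\mathbb R\}$ (distance to the origin over time of a unit-speed station with closest approach $h_0$ at time $t_0$). Two birds with heads $(t_1,h_1),(t_2,h_2)$, $t_1\neq t_2$, intersect in exactly one point $(\hat s,\hat h)$ with $\hat s(t_1,h_1,t_2,h_2)=\frac{t_1^2+h_1^2-t_2^2-h_2^2}{2(t_1-t_2)}$ and $\hat h^2(t_1,h_1,t_2,h_2)=\frac14\big[(t_1-t_2)^2+2(h_1^2+h_2^2)+\frac{(h_2^2-h_1^2)^2}{(t_1-t_2)^2}\big]$. $U^s_r=\{(x,y):y>0,(x-s)^2+y^2<r^2\}$. The handover point process $\mathcal V$ on $\mathbb R$ consists of the abscissas $\hat s$ of intersections $(\hat s,\hat h)$ of pairs of birds with heads in $\mathcal H$ such that $\mathcal H(U^{\hat s}_{\hat h})=0$ (these are the times the closest station changes); it is stationary with intensity $4\sqrt\lambda/\pi$. $\mathbb E$ denotes expectation under $\mathbb P$. *)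

(* Defs.v *)
From HB Require Import structures.
From mathcomp Require Import all_boot all_order all_algebra.
From mathcomp Require Import all_classical all_reals all_analysis.
From mathcomp Require Import measurable_realfun.
Set Implicit Arguments. Unset Strict Implicit. Unset Printing Implicit Defensive.
Import Order.TTheory GRing.Theory Num.Theory.
Import numFieldNormedType.Exports.
Local Open Scope classical_set_scope.
Local Open Scope ring_scope.

Section Handover.
Variable R : realType.

Definition Hplus : set (R * R) := [set p | 0 < p.2].

(* Number of points of a (simple) configuration w in B, in [0, +oo]. *)
Definition npts (w : set (R * R)) (B : set (R * R)) : \bar R :=
  \esum_(x in w `&` B) (1%E : \bar R).

Definition cfg_gen : set (set (set (R * R))) :=
  [set A | exists (B : set (R * R)) (n : nat),
      measurable B /\ A = [set w | npts w B = (n%:R)%:E]].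

Definition Cfg : measurableType (sigma_display cfg_gen) := g_sigma_algebraType cfg_gen.

(* Shift theta_s : sum delta_(T_i,H_i) |-> sum delta_(T_i - s, H_i). *)
Definition theta (s : R) (w : set (R * R)) : set (R * R) :=
  [set p | w (p.1 + s, p.2)].

Definition leb2 := (@lebesgue_measure R \x @lebesgue_measure R)%E.

Definition intens (lam : R) (B : set (R * R)) : \bar R :=
  ((2 * lam)%:E * leb2 (B `&` Hplus))%E.

Definition is_poisson_law (lam : R) (P : probability Cfg R) : Prop :=
  forall (n : nat) (B : nat -> set (R * R)) (k : nat -> nat),
    (forall i, (i < n)%N -> measurable (B i) /\ (intens lam (B i) < +oo)%E) ->
    (forall i j, (i < n)%N -> (j < n)%N -> i <> j -> B i `&` B j = set0) ->
    P (\bigcap_(i in `I_n) [set w : Cfg | npts w (B i) = ((k i)%:R)%:E]) =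
    (\prod_(i < n) (expR (- fine (intens lam (B i))) *
                     fine (intens lam (B i)) ^+ k i / ((k i)`!)%:R))%:E.

(* Intersection point of two radial birds. *)
Definition shat (t1 h1 t2 h2 : R) : R :=
  (t1 ^+ 2 + h1 ^+ 2 - t2 ^+ 2 - h2 ^+ 2) / (2 * (t1 - t2)).
Definition hhat2 (t1 h1 t2 h2 : R) : R :=
  4^-1 * ((t1 - t2) ^+ 2 + 2 * (h1 ^+ 2 + h2 ^+ 2)
          + (h2 ^+ 2 - h1 ^+ 2) ^+ 2 / (t1 - t2) ^+ 2).
Definition hhat (t1 h1 t2 h2 : R) : R := Num.sqrt (hhat2 t1 h1 t2 h2).

Definition Udisk (s r : R) : set (R * R) :=
  [set p | 0 < p.2 /\ (p.1 - s) ^+ 2 + p.2 ^+ 2 < r ^+ 2].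

Definition handover (w : set (R * R)) : set R :=
  [set s | exists t1 h1 t2 h2, w (t1, h1) /\ w (t2, h2) /\ t1 != t2 /\
      s = shat t1 h1 t2 h2 /\ w `&` Udisk s (hhat t1 h1 t2 h2) = set0].

Definition pp_intensity (P : probability Cfg R) (V : set (R * R) -> set R) : \bar R :=
  (\int[P]_w \esum_(s in V w `&` [set x : R | (0 <= x <= 1)%R]) (1%E : \bar R))%E.

Definition palmE (P : probability Cfg R) (V : set (R * R) -> set R)
  (g : set (R * R) -> \bar R) : \bar R :=
  ((\int[P]_w \esum_(s in V w `&` [set x : R | (0 <= x <= 1)%R]) g (theta s w))
   * ((fine (pp_intensity P V))^-1)%:E)%E.

End Handover.

(* Main.v *)
Require Import Defs.
From HB Require Import structures.
From mathcomp Require Import finmap.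
From mathcomp Require Import all_boot all_order all_algebra.
From mathcomp Require Import all_classical all_reals all_analysis.
From mathcomp Require Import measurable_realfun.
From mathcomp Require Import ring lra.
Import Order.TTheory GRing.Theory Num.Theory.
Import numFieldNormedType.Exports.
Local Open Scope classical_set_scope.
Local Open Scope ring_scope.

(** A handover in [0, 1] is the crossing of a unique pair of birds whose disk contains
    no head, unless three heads lie on a circle centred on the axis, which has
    probability zero. Summing over handovers is therefore summing over pairs of heads,
    and two applications of the Mecke formula turn the expectation into (2 lambda)^2
    times an integral over pairs of points of the half plane; by stationarity it depends
    on the first abscissa only through the constraint that the crossing lies in [0, 1],
    which integrates to 1. The Mecke formula itself holds on rectangles of void events
    by independence, and these form a pi-system generating the sigma-algebra.

    For the constant f = 1 the same formula gives the intensity. The void probability is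
    exp(- lambda pi r^2) with 4 t^2 r^2 = ((h + h')^2 + t^2) ((h - h')^2 + t^2), and the
    triple integral is evaluated in the rotated coordinates h + h' and h - h', in which it
    reduces to Gaussian integrals and to the integral of (1 + u^2)^(-3/2), equal to 2.
    This yields 4 sqrt(lambda) / pi, and (2 lambda)^2 pi / (4 sqrt(lambda)) is
    pi lambda^(3/2). *)

(** * Counts and void events *)

Section Configurations.
Context {R : realType}.
Implicit Types (w : set (R * R)) (B : set (R * R)).

(** A point of [Cfg R] is an arbitrary subset of the plane and its sigma-algebra only sees counts in
    fixed Borel sets, so neither sums over the points of a configuration nor conditions on disks
    that move with those points are measurable for free. The remedy is a counting kernel [kappa]
    that agrees with summation over points on the [good] configurations, which carry all the mass:
    sums become kernel integrals, and joint measurability in the configuration and a parameter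
    follows. Void events are preferred to counts as generators because they are stable under finite
    intersection and because adding a point or shifting acts on them explicitly. That no three heads
    are cocyclic is itself obtained from the Mecke formula, applied three times to the number of
    cocyclic triples. The sum over the handovers, a random set, is replaced under the expectation by
    a kernel integral equal to it off a null event; the integral of a nonnegative function being a
    supremum over simple functions, this replacement asks nothing of the original sum. *)

Lemma npts_ge0 w B : (0 <= npts w B)%E.
Proof. exact: esum_ge0. Qed.

Lemma esum_subset (T : choiceType) (A B : set T) (g : T -> \bar R) :
  A `<=` B -> (\esum_(x in A) g x <= \esum_(x in B) g x)%E.
Proof.
move=> AB; apply: le_ereal_sup => _ [F [finF FA] <-]; exists F => //.
by split=> //; exact: subset_trans AB.
Qed.

Lemma esum_cst1 (T : choiceType) (A : set T) : finite_set A ->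
  (\esum_(x in A) (1 : \bar R) = ((size (fset_set A))%:R)%:E)%E.
Proof.
move=> fA; rewrite esum_fset// fsbig_finite//= big_const_seq count_predT.
elim: (size _) => //= n ->; rewrite -EFinD; congr EFin.
by rewrite -[in RHS]addn1 natrD addrC.
Qed.

Lemma npts_eq0 w B : (npts w B = 0)%E <-> w `&` B = set0.
Proof.
split=> [w0|wB]; last by rewrite /npts wB esum_set0.
apply/seteqP; split=> // x wBx.
have : (\esum_(y in [set x]) (1 : \bar R) <= npts w B)%E.
  by apply: esum_subset => // y ->.
by rewrite w0 esum_set1// lee_fin ler10.
Qed.

Lemma npts_infinite w B : ~ finite_set (w `&` B) -> npts w B = +oo%E.
Proof.
move=> iA; apply/eq_infty => r.
have [X XA ltr] := infinite_set_fset (Num.truncn r).+1 iA.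
apply: (@le_trans _ _ (\esum_(x in [set` X]) (1 : \bar R))%E); last first.
  by apply: esum_subset.
rewrite esum_cst1 ?set_fsetK// lee_fin.
by rewrite (le_trans (ltW (truncnS_gt r)))// ler_nat.
Qed.

Lemma npts_cases w B :
  (exists n : nat, npts w B = (n%:R)%:E) \/ npts w B = +oo%E.
Proof.
have [fA|iA] := pselect (finite_set (w `&` B)).
  by left; eexists; exact: esum_cst1.
by right; exact: npts_infinite.
Qed.

Lemma npts_finite w B : (npts w B < +oo)%E -> finite_set (w `&` B).
Proof. by move=> h; apply: contrapT => /npts_infinite E; rewrite E in h. Qed.

(** Index of the square of side 1/n containing the point, encoded by [pickle] so that sums over
    cells are series over [nat]. These partitions are not nested; only their eventual separation of
    points is used. *)
Definition cell (n : nat) (x : R * R) : nat :=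
  pickle (Num.floor (n%:R * x.1), Num.floor (n%:R * x.2)).

Lemma measurable_floor_fiber (g : R * R -> R) (i : int) :
  measurable_fun setT g -> measurable [set x | Num.floor (g x) = i].
Proof.
move=> mg.
rewrite (_ : [set x | _] = setT `&` g @^-1` `[i%:~R, (i + 1)%:~R[%classic).
  by apply: mg.
rewrite setTI; apply/seteqP; split=> x /=; rewrite in_itv/=.
  by move/eqP; rewrite floor_eq.
by rewrite -floor_eq => /eqP.
Qed.

Lemma measurable_cell n k : measurable (cell n @^-1` [set k]).
Proof.
have [[[i j] kE]|nk] := pselect (exists z : int * int, pickle z = k); last first.
  rewrite (_ : _ @^-1` _ = set0)//; apply/seteqP; split=> // x /= xk.
  by apply: nk; exists (Num.floor (n%:R * x.1), Num.floor (n%:R * x.2)).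
rewrite (_ : _ @^-1` _ = [set x | Num.floor (n%:R * x.1) = i] `&`
                        [set x | Num.floor (n%:R * x.2) = j]).
  by apply: measurableI; apply: measurable_floor_fiber; apply: measurable_funM.
rewrite -kE /cell; apply/seteqP; split=> x /=.
  by move/(pcan_inj pickleK) => [-> ->].
by move=> [-> ->].
Qed.

(** Numbers with the same floor differ by less than 1, whereas [n * |a - b|] is eventually larger
    than 1. *)
Lemma floor_separates (a b : R) : a != b ->
  \forall n \near \oo, Num.floor (n%:R * a) != Num.floor (n%:R * b).
Proof.
move=> ab; have d0 : 0 < `|a - b| by rewrite normr_gt0 subr_eq0.
near=> n; apply/eqP => fab.
have : `|n%:R * a - n%:R * b| < 1.
  have /andP[] := floor_itv (n%:R * a); have /andP[] := floor_itv (n%:R * b).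
  rewrite fab intrD ltr_norml; move: (Num.floor _)%:~R => z.
  by lra.
rewrite -mulrBr normrM normr_nat -ltr_pdivlMr// ltNge => /negP; apply.
apply: ltW; near: n; exact: nbhs_infty_gtr.
Unshelve. all: by end_near. Qed.

(** Each pair of distinct points is separated for all large [n], and there are finitely many
    pairs. *)
Lemma cell_separates (F : set (R * R)) : finite_set F ->
  exists n, set_inj F (cell n).
Proof.
move=> fF.
have /(_ _)/filter_ex[] := @filter_bigI nat _ (fset_set (F `*` F))
    (fun p => [set n | p.1 <> p.2 -> cell n p.1 <> cell n p.2]) \oo eventually_filter.
  move=> [x y] _ /=; have [->|xy] := eqVneq x y; first by near=> n.
  have [xy1|xy1] := eqVneq x.1 y.1.
    have xy2 : x.2 != y.2.
      by apply: contra xy => /eqP xy2; case: x y xy1 xy2 => ? ? [? ?] /= -> ->.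
    near=> n => _ /(pcan_inj pickleK) [_]; apply/eqP; near: n.
    exact: floor_separates.
  near=> n => _ /(pcan_inj pickleK) [+ _]; apply/eqP; near: n.
  exact: floor_separates.
move=> n /= nF; exists n => x y /set_mem xF /set_mem yF cxy.
apply: contrapT => xy; apply: (nF (x, y)) => //=.
by rewrite in_fset_set ?inE//; exact: finite_setX.
Unshelve. all: by end_near. Qed.

(* Cells of mesh 1/n eventually separate any finite set of points, so a count is a
   supremum of numbers of nonempty cells, hence a function of void events alone. *)
Lemma npts_cellE w B : npts w B =
  esups (fun n => \sum_(k <oo)
    (\1_[set k | w `&` (B `&` cell n @^-1` [set k]) !=set0] k)%:E)%E 0.
Proof.
have imE n : (\sum_(k <oo)
    (\1_[set k | w `&` (B `&` cell n @^-1` [set k]) !=set0] k)%:E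
    = \esum_(k in cell n @` (w `&` B)) (1 : \bar R))%E.
  rewrite nneseries_esumT//.
  rewrite [RHS]esum_mkcond; apply: eq_esum => k _.
  rewrite indicE (_ : [set _ | _] = cell n @` (w `&` B)); first by case: ifPn.
  apply/seteqP; split=> [i /= [x [wx [Bx <-]]]|_ [x [wx Bx] <-]]; first by exists x.
  by exists x.
apply/eqP; rewrite eq_le; apply/andP; split.
  apply: ge_ereal_sup => _ [F [finF FA] <-].
  have [n cn] := cell_separates _ finF.
  apply: (@le_trans _ _ (\esum_(k in cell n @` (w `&` B)) (1 : \bar R))%E).
    rewrite -esum_fset// -(@esum_image _ _ _ F (cell n) (fun=> 1%E))//.
    by apply: esum_subset; exact: image_subset.
  by rewrite -imE; apply: ereal_sup_ubound => /=; exists n.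
apply: ge_ereal_sup => _ [n _ <-]; rewrite imE.
(* [g] selects one point in each cell that is met; distinct cells give distinct points, so the
   number of cells never exceeds the count. *)
have /choice[g gP] : forall k, exists y,
    (cell n @` (w `&` B)) k -> (w `&` B) y /\ cell n y = k.
  move=> k.
  have [[x wx <-]|nk] := pselect ((cell n @` (w `&` B)) k); first by exists x.
  by exists (0, 0).
rewrite -(@esum_image _ _ _ _ g (fun=> 1%E)).
  by apply: esum_subset => _ [k /gP[wg _] <-].
by move=> i j /set_mem/gP[_ {2}<-] /set_mem/gP[_ {2}<-] ->.
Qed.

Definition void_gen : set (set (set (R * R))) :=
  [set [set w | w `&` B = set0] | B in measurable].

(** A second copy of the configuration space, with the sigma-algebra of void events; it serves only
    until [Cfg_void_gen] identifies the two. *)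
Definition VCfg : measurableType (sigma_display void_gen) :=
  g_sigma_algebraType void_gen.

Lemma nonvoidE w B : w `&` B !=set0 <-> ~ (w `&` B = set0).
Proof. by split=> [/set0P/eqP//|/eqP/set0P]. Qed.

(** Stated for a map into bare sets, so that it applies to either sigma-algebra on configurations
    and to the thinned configurations [piece]. *)
Lemma measurable_npts_of d (T : measurableType d) (phi : T -> set (R * R)) B :
  (forall B', measurable B' -> measurable [set t | phi t `&` B' = set0]) ->
  measurable B -> measurable_fun setT (fun t => npts (phi t) B).
Proof.
move=> mphi mB; rewrite (_ : (fun t => _) = fun t => esups (fun n => \sum_(k <oo)
    (\1_[set t | phi t `&` (B `&` cell n @^-1` [set k]) !=set0] t)%:E)%E 0).
  apply: measurable_fun_esups => n; apply: ge0_emeasurable_sum => k *.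
    by rewrite lee_fin.
  apply/measurable_EFinP/measurable_indic.
  rewrite (_ : [set _ | _] =
      ~` [set t | phi t `&` (B `&` cell n @^-1` [set k]) = set0]).
    by apply/measurableC/mphi/measurableI => //; exact: measurable_cell.
  by apply/seteqP; split=> t /nonvoidE.
apply/funext => t; rewrite npts_cellE; congr (esups _ _); apply/funext => n.
Qed.

Lemma measurable_void B : measurable B ->
  measurable [set w : Cfg R | w `&` B = set0].
Proof.
move=> mB; apply: sub_sigma_algebra; exists B, 0%N; split=> //.
by apply/seteqP; split=> w /npts_eq0.
Qed.

Lemma measurable_npts B : measurable B ->
  measurable_fun setT (fun w : Cfg R => npts w B).
Proof. by apply: (@measurable_npts_of _ (Cfg R) id) => ?; exact: measurable_void. Qed.

Lemma Cfg_void_gen : (@measurable _ (Cfg R)) = <<s void_gen >>.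
Proof.
apply/seteqP; split.
  apply: smallest_sub; first exact: smallest_sigma_algebra.
  move=> _ [B [n [mB ->]]].
  have := @measurable_npts_of _ VCfg id B _ mB.
  move=> /(_ _ measurableT [set n%:R%:E] (emeasurable_set1 _)).
  rewrite setTI; apply => B' mB'.
  by apply: sub_sigma_algebra; exists B'.
apply: smallest_sub; first exact: sigma_algebra_measurable.
by move=> _ [B mB <-]; exact: measurable_void.
Qed.

Lemma measurable_fun_Cfg d (T : measurableType d) (phi : T -> Cfg R) :
  (forall B, measurable B -> measurable [set t | phi t `&` B = set0]) ->
  measurable_fun setT phi.
Proof.
move=> mphi; apply: (@measurability _ _ T (Cfg R) setT phi void_gen); first exact: Cfg_void_gen.
by move=> _ [_ [B mB <-] <-]; rewrite setTI; exact: mphi.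
Qed.

End Configurations.

(** * The counting kernel *)

Section Counting.
Context {R : realType}.
Implicit Types (w : set (R * R)) (B : set (R * R)).

Lemma npts_set0 w : npts w set0 = 0%E.
Proof. by rewrite /npts setI0 esum_set0. Qed.

Lemma npts_bigcup w (F : nat -> set (R * R)) : trivIset setT F ->
  npts w (\bigcup_i F i) = (\sum_(i <oo) npts w (F i))%E.
Proof.
move=> tF; rewrite /npts setI_bigcupr nneseries_sum_bigcup//.
by apply: trivIset_setIl.
Qed.

Lemma npts_sigma_additive w : semi_sigma_additive (npts w).
Proof.
move=> F mF tF mUF; rewrite npts_bigcup//.
by apply: is_cvg_nneseries => *; exact: npts_ge0.
Qed.

HB.instance Definition _ w :=
  isMeasure.Build _ _ R (npts w) (npts_set0 w) (npts_ge0 w) (@npts_sigma_additive w).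

Lemma measurable_point (x : R * R) : measurable [set x].
Proof.
case: x => a b; rewrite (_ : [set _] = [set a] `*` [set b]).
  by apply: measurableX.
by apply/seteqP; split=> -[c d] /= [-> ->].
Qed.

Lemma measurable_countable w : countable w -> measurable w.
Proof.
by move=> cw; apply: countable_measurable => // x; exact: measurable_point.
Qed.

(** Countability makes [w] measurable, hence its complement null for [npts w]; the integral then
    splits along the singletons of [w], enumerated by an injection into [nat]. *)
Lemma integral_npts w (g : R * R -> \bar R) : countable w ->
  (forall x, 0 <= g x)%E -> measurable_fun setT g ->
  (\int[npts w]_x g x = \esum_(x in w) g x)%E.
Proof.
move=> cw g0 mg; have /countable_injP[e einj] := cw.
pose F k := w `&` [set x | e x = k].
have wF : w = \bigcup_k F k.
  by apply/seteqP; split=> [x wx|x [k _ []]//]; exists (e x).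
have tF : trivIset setT F.
  apply/trivIsetP => i j _ _ ij; apply/seteqP; split=> // x [] [_ /= xi] [_ /= xj].
  by move: ij; rewrite -xi -xj eqxx.
have mF k : measurable (F k).
  by apply: measurable_countable; apply: sub_countable cw; apply: subset_card_le => x [].
have mw : measurable w by exact: measurable_countable.
rewrite (@ge0_negligible_integral _ _ _ _ setT (~` w))//; last 2 first.
- exact: measurableC.
- by rewrite /= npts_eq0 setICr.
rewrite setTD setCK [in LHS]wF ge0_integral_bigcup//; last exact: measurable_funTS.
rewrite [in RHS]wF nneseries_sum_bigcup//.
apply: eq_eseriesr => k _.
have [[x [wx ex]]|Fk0] := pselect (exists x, F k x).
  have Fx : F k = [set x].
    apply/seteqP; split=> [y [wy ey]|y ->]; last by [].
    by apply: einj; rewrite ?inE// ey ex.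
  rewrite Fx esum_set1// (eq_integral (cst (g x))); last by move=> y /set_mem ->.
  rewrite integral_cst//=; last exact: measurable_point.
  rewrite [X in (_ * X)%E](_ : _ = 1%E) ?mule1//.
  by rewrite -wF /npts (_ : w `&` _ = [set x]) ?esum_set1//; apply/setIidPr => y ->.
rewrite (_ : F k = set0) ?integral_set0 ?esum_set0//.
by apply/seteqP; split=> // x Fx; apply: Fk0; exists x.
Qed.

(** Annuli of the l1 norm: a countable Borel partition of the plane into bounded sets, which serves
    for local finiteness, s-finiteness and sigma-finiteness alike. *)
Definition annulus (m : nat) : set (R * R) :=
  [set p | Num.floor (`|p.1| + `|p.2|) = m%:Z].

Lemma measurable_annulus m : measurable (annulus m).
Proof.
apply: measurable_floor_fiber; apply: measurable_funD => //.
  by apply: measurableT_comp.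
by apply: measurableT_comp.
Qed.

Lemma annulus_cover : \bigcup_m annulus m = setT.
Proof.
apply/seteqP; split=> // p _; exists `|Num.floor (`|p.1| + `|p.2|)|%N => //.
by rewrite /annulus/= gez0_abs// floor_ge0 addr_ge0.
Qed.

Lemma trivIset_annulus : trivIset setT annulus.
Proof.
by apply/trivIsetP => i j _ _ /eqP ij; apply/seteqP; split=> // x [/=]; rewrite /annulus/= => -> [].
Qed.

(* Points of [Cfg R] are arbitrary sets. The Poisson law charges only the [good]
   ones; [rho] empties all others so that counting on [rho w] is an s-finite kernel. *)
Definition good w := w `<=` @Hplus R /\ forall m, (npts w (annulus m) < +oo)%E.

Definition rho w : set (R * R) := [set p | good w /\ w p].

Lemma rho_good w : good w -> rho w = w.
Proof. by move=> gw; apply/seteqP; split=> [p []|p]. Qed.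

Lemma rho_bad w : ~ good w -> rho w = set0.
Proof. by move=> gw; apply/seteqP; split=> [p []|p]. Qed.

Lemma good_rho w : good (rho w).
Proof.
have [gw|bw] := pselect (good w); first by rewrite rho_good.
rewrite rho_bad//; split=> // m.
by rewrite (_ : npts _ _ = 0%E) //; apply/npts_eq0; rewrite set0I.
Qed.

Lemma measurable_Hplus : measurable (@Hplus R).
Proof.
rewrite (_ : @Hplus R = setT `*` `]0, +oo[%classic); first exact: measurableX.
by apply/seteqP; split=> -[a b] /=; rewrite /Hplus/= in_itv/= andbT => // -[].
Qed.

Lemma measurable_good : measurable [set w : Cfg R | good w].
Proof.
rewrite (_ : [set _ | _] = [set w : Cfg R | w `&` ~` @Hplus R = set0] `&`
    \bigcap_m [set w : Cfg R | (npts w (annulus m) < +oo)%E]).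
  apply: measurableI; first by apply: measurable_void; apply: measurableC; exact: measurable_Hplus.
  apply: bigcap_measurable => //= m _.
  rewrite -[X in measurable X]setTI; apply: emeasurable_fun_infty_o => //.
  by apply: measurable_npts; exact: measurable_annulus.
apply/seteqP; split=> w /=.
  move=> [wH wD]; split; last by move=> m _; exact: wD.
  by apply/seteqP; split=> // p [/wH].
move=> [wH wD]; split; last by move=> m; exact: wD.
by move=> p wp; apply: contrapT => Hp; have : set0 p by rewrite -wH.
Qed.

Lemma good_countable w : good w -> countable w.
Proof.
move=> [_ gw]; rewrite -(setIT w) -annulus_cover setI_bigcupr.
apply: bigcup_countable => // m _; exact/finite_set_countable/npts_finite/gw.
Qed.

(* Fixing the number of points in the annulus makes each piece a finite kernel. *)
Definition piece m k w : set (R * R) :=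
  [set p | (good w /\ npts w (annulus m) = k%:R%:E) /\ (w `&` annulus m) p].

Definition kpiece m k : Cfg R -> {measure set (R * R) -> \bar R} :=
  fun w => npts (piece m k w).

Lemma measurable_piece m k B : measurable B ->
  measurable [set w : Cfg R | piece m k w `&` B = set0].
Proof.
move=> mB; rewrite (_ : [set _ | _] =
    ~` ([set w : Cfg R | good w] `&` [set w : Cfg R | npts w (annulus m) = k%:R%:E])
    `|` [set w : Cfg R | w `&` (annulus m `&` B) = set0]).
  apply: measurableU.
    apply/measurableC/measurableI; first exact: measurable_good.
    rewrite -[X in measurable X]setTI.
    exact: (measurable_npts (annulus m) (measurable_annulus m) measurableT
      [set k%:R%:E] (emeasurable_set1 _)).
  by apply: measurable_void; apply: measurableI => //; exact: measurable_annulus.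
apply/seteqP; split=> w /=.
  move=> w0; have [gw|] := pselect (good w /\ npts w (annulus m) = k%:R%:E); last by left.
  by right; apply/seteqP; split=> // p [wp [ap Bp]]; rewrite -w0.
move=> [gw|w0]; first by apply/seteqP; split=> // p [[/gw]].
by apply/seteqP; split=> // p [[_ [wp ap] Bp]]; rewrite -w0.
Qed.

Lemma measurable_kpiece m k U : measurable U -> measurable_fun setT (kpiece m k ^~ U).
Proof.
by apply: (@measurable_npts_of _ _ (Cfg R)) => B; exact: measurable_piece.
Qed.

HB.instance Definition _ m k := isKernel.Build _ _ (Cfg R) (R * R)%type R
  (kpiece m k) (measurable_kpiece m k).

Lemma kpiece_uub m k : measure_fam_uub (kpiece m k).
Proof.
exists (k.+1%:R) => w; apply: (@le_lt_trans _ _ k%:R%:E); last by rewrite lte_fin ltr_nat.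
have [[gw wk]|nk] := pselect (good w /\ npts w (annulus m) = k%:R%:E).
  by rewrite -wk; apply: esum_subset => p [[_ wap] _].
rewrite (_ : kpiece m k w setT = 0%E) ?lee_fin//.
by apply/npts_eq0; apply/seteqP; split=> // p [[]].
Qed.

HB.instance Definition _ m k := Kernel_isFinite.Build _ _ (Cfg R) (R * R)%type R
  (kpiece m k) (kpiece_uub m k).

Definition kannulus m : R.-sfker (Cfg R) ~> (R * R)%type :=
  kseries (fun k => kpiece m k : R.-sfker (Cfg R) ~> (R * R)%type).

Definition kappa : R.-sfker (Cfg R) ~> (R * R)%type := kseries kannulus.

(** For a good [w] exactly one [k] contributes in each annulus, its number of points; for a bad [w]
    every piece is empty, and so is [rho w]. *)
Lemma kappaE w U : measurable U -> kappa w U = npts (rho w) U.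
Proof.
move=> mU; rewrite -[U in RHS]setIT -annulus_cover setI_bigcupr npts_bigcup; last first.
  by apply: trivIset_setIl; exact: trivIset_annulus.
apply: eq_eseriesr => m _; have [gw|bw] := pselect (good w); last first.
  rewrite rho_bad// (_ : npts _ _ = 0%E); last by apply/npts_eq0; rewrite set0I.
  apply: eseries0 => k _ _; apply/npts_eq0; apply/seteqP.
  by split=> // p [] [] [] /bw.
rewrite rho_good// {1}/npts.
rewrite (_ : w `&` _ = \bigcup_k (piece m k w `&` U)).
  rewrite nneseries_sum_bigcup//.
  apply/trivIsetP => i j _ _ ij; apply/seteqP; split=> // p.
  move=> [[[[_ wi] _] _] [[[_ wj] _] _]].
  by move: wi; rewrite wj => -[/eqP]; rewrite eqr_nat eq_sym (negbTE ij).
apply/seteqP; split=> [p [wp [Up ap]]|p [k _ [[_ [wp ap]] Up]]]; last by [].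
have [[k wk]|woo] := npts_cases w (annulus m); first by exists k.
by have := gw.2 m; rewrite woo.
Qed.

Lemma integral_kappa w (g : R * R -> \bar R) :
  (forall x, 0 <= g x)%E -> measurable_fun setT g ->
  (\int[kappa w]_x g x = \esum_(x in rho w) g x)%E.
Proof.
move=> g0 mg; rewrite -integral_npts//; last exact/good_countable/good_rho.
by apply: eq_measure_integral => A mA _; exact: kappaE.
Qed.

End Counting.

(** * Poisson void probabilities *)

Section PoissonSeries.
Context {R : realType}.

Definition ppmf (x : R) (k : nat) : R := expR (- x) * x ^+ k / (k`!)%:R.

Lemma ppmf0 x : ppmf x 0 = expR (- x).
Proof. by rewrite /ppmf expr0 fact0 mulr1 divr1. Qed.

Lemma ppmf_ge0 x k : 0 <= x -> 0 <= ppmf x k.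
Proof. by move=> x0; rewrite /ppmf divr_ge0// mulr_ge0 ?expR_ge0 ?exprn_ge0. Qed.

Lemma nneseries_ppmf x : 0 <= x -> (\sum_(k <oo) (ppmf x k)%:E = 1)%E.
Proof.
move=> x0; rewrite [RHS](_ : _ = (expR (- x))%:E * (expR x)%:E)%E; last first.
  by rewrite -EFinM expRN mulVf ?gt_eqF ?expR_gt0.
under eq_eseriesr do rewrite /ppmf -mulrA EFinM.
rewrite nneseriesZl/=; last first.
  by move=> n _; rewrite lee_fin divr_ge0// exprn_ge0.
congr *%E; rewrite expRE -EFin_lim; last first.
  rewrite /pseries/=; under eq_fun do rewrite mulrC.
  exact: is_cvg_series_exp_coeff.
apply/congr_lim/funext => n/=; rewrite /pseries/= /series/= -sumEFin//.
by under eq_bigr do rewrite mulrC.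
Qed.

Lemma nneseries_shift1 (a : nat -> \bar R) : (forall k, 0 <= a k)%E ->
  (\sum_(1 <= k <oo) a k = \sum_(k <oo) a k.+1)%E.
Proof.
move=> a0; apply/cvg_lim => //; rewrite -cvg_shiftS /=.
rewrite (_ : (fun n => _) = fun n => (\sum_(0 <= k < n) a k.+1)%E).
  exact: is_cvg_nneseries.
by apply/funext => n; rewrite big_add1.
Qed.

Lemma prod_I2 (F : nat -> R) : \prod_(i < 2) F i = F 0%N * F 1%N.
Proof. by rewrite big_ord_recl big_ord1. Qed.

Lemma nneseries_ppmf_mean x : 0 <= x ->
  (\sum_(k <oo) (k%:R * ppmf x k)%:E = x%:E)%E.
Proof.
move=> x0; rewrite nneseries_recl//; last first.
  by move=> k _; rewrite lee_fin mulr_ge0// ppmf_ge0.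
rewrite mul0r add0e nneseries_shift1; last first.
  by move=> k; rewrite lee_fin mulr_ge0// ppmf_ge0.
rewrite (@eq_eseriesr _ _ (fun k => x%:E * (ppmf x k)%:E)%E); last first.
  move=> k _; rewrite -EFinM; congr EFin.
  rewrite /ppmf factS exprS natrM; field.
  by rewrite pnatr_eq0 -lt0n fact_gt0 /= nat1r pnatr_eq0.
rewrite nneseriesZl; last by move=> k _; rewrite lee_fin ppmf_ge0.
by rewrite nneseries_ppmf// mule1.
Qed.

End PoissonSeries.

Section PoissonFacts.
Context {R : realType} (lam : R) (hlam : 0 < lam).
Context (P : probability (Cfg R) R) (hP : is_poisson_law lam P).
Implicit Types (w : set (R * R)) (B C : set (R * R)).

Lemma intens_ge0 B : (0 <= intens lam B)%E.
Proof. by rewrite mule_ge0// lee_fin mulr_ge0// ltW. Qed.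

Lemma leb2_le B C : measurable B -> measurable C -> B `<=` C ->
  (leb2 B <= leb2 C)%E.
Proof.
by move=> mB mC BC; rewrite /leb2 /=; apply: le_measure => //; rewrite inE.
Qed.

Lemma intens_le B C : measurable B -> measurable C -> B `<=` C ->
  (intens lam B <= intens lam C)%E.
Proof.
move=> mB mC BC; apply: lee_wpmul2l; first by rewrite lee_fin mulr_ge0// ltW.
by apply: leb2_le; [apply: measurableI|apply: measurableI|exact: setSI];
  rewrite //; exact: measurable_Hplus.
Qed.

Lemma intens_setU B C : measurable B -> (intens lam B < +oo)%E ->
  measurable C -> (intens lam C < +oo)%E -> (intens lam (B `|` C) < +oo)%E.
Proof.
move=> mB fB mC fC; have mH := @measurable_Hplus R.
apply: (@le_lt_trans _ _ (intens lam B + intens lam C)%E); last exact: lte_add_pinfty.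
rewrite /intens setIUl -ge0_muleDr//; apply: lee_wpmul2l.
  by rewrite lee_fin mulr_ge0// ltW.
by rewrite /leb2 /=; apply: measureU2; exact: measurableI.
Qed.

Lemma voidU B C : [set w : Cfg R | w `&` B = set0] `&` [set w : Cfg R | w `&` C = set0]
  = [set w : Cfg R | w `&` (B `|` C) = set0].
Proof.
apply/seteqP; split=> w /=; rewrite setIUr; first by move=> [-> ->]; rewrite setU0.
by move=> h; split; apply/seteqP; split=> // x wBx; rewrite -[set0]h; [left|right].
Qed.

Lemma leb2_annulus m : (leb2 (@annulus R m) < +oo)%E.
Proof.
pose I : set R := `[- (m.+1%:R), m.+1%:R]%classic.
apply: (@le_lt_trans _ _ (leb2 (I `*` I))).
  apply: leb2_le; [exact: measurable_annulus|apply: measurableX; exact: measurable_itv|].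
  move=> -[a b]; rewrite /annulus/= => /eqP; rewrite floor_eq => /andP[_].
  rewrite intrD -pmulrn natr1 => ab; rewrite /I/= !in_itv/= -!ler_norml.
  by split; apply: ltW; apply: le_lt_trans ab; rewrite ?lerDl ?lerDr.
rewrite /leb2 product_measure1E; [|exact: measurable_itv..].
have Ioo : (lebesgue_measure I < +oo)%E.
  by rewrite /I lebesgue_measure_itv/=; case: ifPn => // _; rewrite -EFinB ltry.
by rewrite lte_mul_pinfty// ge0_fin_numE.
Qed.

Lemma intens_annulus m : (intens lam (annulus m) < +oo)%E.
Proof.
rewrite /intens lte_mul_pinfty ?lee_fin ?mulr_ge0 ?(ltW hlam)//.
apply: le_lt_trans (leb2_annulus m); apply: leb2_le.
- apply: measurableI; [exact: measurable_annulus|exact: measurable_Hplus].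
- exact: measurable_annulus.
- exact: subIsetl.
Qed.

Lemma intens_annulusI m B : measurable B -> (intens lam (B `&` annulus m) < +oo)%E.
Proof.
move=> mB; apply: le_lt_trans (intens_annulus m); apply: intens_le => //.
  by apply: measurableI => //; exact: measurable_annulus.
exact: measurable_annulus.
Qed.

Lemma poisson_count C k : measurable C -> (intens lam C < +oo)%E ->
  P [set w : Cfg R | npts w C = k%:R%:E] = (ppmf (fine (intens lam C)) k)%:E.
Proof.
move=> mC fC; have := @hP 1%N (fun=> C) (fun=> k).
rewrite big_ord1 => <-.
- by congr (P _); apply/seteqP; split=> [w wk i _//|w /(_ 0%N)]; exact.
- by [].
- by move=> [|i] [|j].
Qed.

(** The one place where independence over disjoint sets enters: the Poisson law for two sets, with
    counts [k] and 0. *)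
Lemma poisson_count_void C B k : measurable C -> (intens lam C < +oo)%E ->
  measurable B -> (intens lam B < +oo)%E -> C `&` B = set0 ->
  P ([set w : Cfg R | npts w C = k%:R%:E] `&` [set w : Cfg R | w `&` B = set0]) =
  (ppmf (fine (intens lam C)) k * expR (- fine (intens lam B)))%:E.
Proof.
move=> mC fC mB fB CB.
pose D i := if i is 0%N then C else B; pose l i := if i is 0%N then k else 0%N.
rewrite (_ : ppmf _ _ * _ = \prod_(i < 2) (expR (- fine (intens lam (D i))) *
    fine (intens lam (D i)) ^+ l i / ((l i)`!)%:R)); last first.
  by rewrite -ppmf0; apply: esym; exact: (prod_I2 (fun i => ppmf (fine (intens lam (D i))) (l i))).
rewrite -hP.
- congr (P _); apply/seteqP; split=> [w [/= wC wB] [|[|i]]//= _|w wCB].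
    exact/npts_eq0.
  by split; [exact: (wCB 0%N)|apply/npts_eq0; exact: (wCB 1%N)].
- by case=> [|[|i]].
- by move=> [|[|i]] [|[|j]]//= _ _ _; rewrite setIC.
Qed.

Lemma prob_void B : measurable B -> (intens lam B < +oo)%E ->
  P [set w : Cfg R | w `&` B = set0] = (expR (- fine (intens lam B)))%:E.
Proof.
move=> mB fB; have := @poisson_count B 0 mB fB.
rewrite ppmf0 => <-; congr (P _).
by apply/seteqP; split=> w /npts_eq0.
Qed.

Lemma measurable_count C k : measurable C ->
  measurable [set w : Cfg R | npts w C = k%:R%:E].
Proof.
move=> mC; rewrite -[X in measurable X]setTI.
exact: (measurable_npts C mC measurableT [set k%:R%:E] (emeasurable_set1 _)).
Qed.

Lemma measurable_infinite C : measurable C ->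
  measurable [set w : Cfg R | npts w C = +oo%E].
Proof.
move=> mC; rewrite -[X in measurable X]setTI.
exact: (measurable_npts C mC measurableT [set +oo%E] (emeasurable_set1 _)).
Qed.

Lemma trivIset_count C (E : set (Cfg R)) :
  trivIset setT (fun k : nat => [set w : Cfg R | npts w C = k%:R%:E] `&` E).
Proof.
apply/trivIsetP => i j _ _ ij; apply/seteqP; split=> // w [[/= wi _] [wj _]].
by move: wi; rewrite wj => -[/eqP]; rewrite eqr_nat eq_sym (negbTE ij).
Qed.

(** The Poisson masses of the finite counts already add up to 1. *)
Lemma prob_infinite C : measurable C -> (intens lam C < +oo)%E ->
  P [set w : Cfg R | npts w C = +oo%E] = 0%E.
Proof.
move=> mC fC.
have mF k := measurable_count C k mC.
have -> : [set w : Cfg R | npts w C = +oo%E] =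
    ~` \bigcup_k ([set w : Cfg R | npts w C = k%:R%:E] `&` setT).
  apply/seteqP; split=> w /=; first by move=> woo [k _ []] /=; rewrite woo.
  by move=> nk; have [[k wk]|//] := npts_cases w C; exfalso; apply: nk; exists k.
rewrite probability_setC; last by apply: bigcup_measurable => k _; exact: measurableI.
rewrite measure_semi_bigcup//; last 3 first.
- by move=> k; exact: measurableI.
- exact: trivIset_count.
- by apply: bigcup_measurable => k _; exact: measurableI.
rewrite (@eq_eseriesr _ _ (fun k => (ppmf (fine (intens lam C)) k)%:E)).
  by rewrite nneseries_ppmf ?subee// fine_ge0// intens_ge0.
by move=> k _; rewrite setIT; exact: poisson_count.
Qed.

(** By independence the mean count factors out of the void event; this is the identity to which the
    Mecke formula reduces on rectangles. *)
Lemma mean_count_void C B : measurable C -> (intens lam C < +oo)%E ->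
  measurable B -> (intens lam B < +oo)%E -> C `&` B = set0 ->
  (\int[P]_(w in [set w : Cfg R | w `&` B = set0]) npts w C =
   intens lam C * (expR (- fine (intens lam B)))%:E)%E.
Proof.
move=> mC fC mB fB CB; set E := [set w | _].
have mE : measurable E by exact: measurable_void.
have mN := measurable_infinite C mC.
rewrite (@ge0_negligible_integral _ _ _ _ E _ _ mN)//; last 2 first.
- apply: measurable_funTS; exact: measurable_npts.
- exact: prob_infinite.
have -> : E `\` [set w : Cfg R | npts w C = +oo%E] =
    \bigcup_k ([set w : Cfg R | npts w C = k%:R%:E] `&` E).
  apply/seteqP; split=> w /=.
    by move=> [Ew /= nw]; have [[k wk]|//] := npts_cases w C; exists k.
  by move=> [k _ [wk Ew]]; split=> //=; rewrite wk.
have mF k : measurable ([set w : Cfg R | npts w C = k%:R%:E] `&` E).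
  by apply: measurableI => //; exact: measurable_count.
rewrite ge0_integral_bigcup//; last 2 first.
- apply: measurable_funTS; exact: measurable_npts.
- exact: trivIset_count.
have l0 : 0 <= fine (intens lam C) by rewrite fine_ge0// intens_ge0.
rewrite (@eq_eseriesr _ _ (fun k => (expR (- fine (intens lam B)))%:E *
    (k%:R * ppmf (fine (intens lam C)) k)%:E)%E); last first.
  move=> k _; rewrite (eq_integral (cst k%:R%:E)); last by move=> w /set_mem[].
  transitivity (k%:R%:E * P ([set w : Cfg R | npts w C = k%:R%:E] `&` E))%E.
    exact: integral_cst.
  rewrite (poisson_count_void C B k)//.
  by rewrite -!EFinM; congr EFin; ring.
rewrite nneseriesZl; last by move=> k _; rewrite lee_fin mulr_ge0// ppmf_ge0.
rewrite nneseries_ppmf_mean// muleC; congr (_ * _)%E.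
by rewrite fineK// ge0_fin_numE// intens_ge0.
Qed.

(** Bad configurations are covered by countably many null events: index 0 codes a point outside the
    half plane, index [m'.+1] infinitely many points in the annulus [m']. *)
Lemma negligible_bad : P (~` [set w : Cfg R | good w]) = 0%E.
Proof.
have mD := @measurable_annulus R.
apply/eqP; rewrite eq_le measure_ge0 andbT.
pose F (m : nat) : set (Cfg R) := if m is m'.+1 then
  [set w : Cfg R | npts w (annulus m') = +oo%E] else
  ~` [set w : Cfg R | w `&` ~` @Hplus R = set0].
have mH : measurable (~` @Hplus R) by apply: measurableC; exact: measurable_Hplus.
have iH : intens lam (~` @Hplus R) = 0%E.
  by rewrite /intens setICl /leb2 measure0 mule0.
have mF m : measurable (F m).
  case: m => [|m] /=; first by apply: measurableC; exact: measurable_void.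
  exact: measurable_infinite.
have F0 m : P (F m) = 0%E.
  case: m => [|m] /=; last by apply: prob_infinite => //; exact: intens_annulus.
  rewrite probability_setC; last exact: measurable_void.
  by rewrite prob_void// ?iH// oppr0 expR0 subee.
apply: (@le_trans _ _ (P (\bigcup_m F m))).
  apply: le_measure; rewrite ?inE.
  - by apply: measurableC; exact: measurable_good.
  - exact: bigcup_measurable.
  - move=> w /= bw; apply: contrapT => nF; apply: bw; split.
      move=> p wp; apply: contrapT => Hp; apply: nF; exists 0%N => //= w0.
      by have : set0 p by rewrite -w0.
    move=> m; rewrite ltey; apply/eqP => woo; apply: nF.
    by exists m.+1.
apply: le_trans (measure_sigma_subadditive P mF _ _) _ => //; first exact: bigcup_measurable.
by rewrite eseries0// => m _ _; exact: F0.
Qed.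

End PoissonFacts.

(** * The Mecke formula *)

Section IntegralFacts.
Context d (T : measurableType d) (R : realType).
Implicit Types mu : {measure set T -> \bar R}.

Import HBNNSimple.

(* No measurability is required: the integral of a nonnegative function is by
   definition a supremum over the simple functions below it. *)
Lemma le_integral_off_negligible mu (G : set T) (f g : T -> \bar R) :
  measurable G -> mu (~` G) = 0%E ->
  (forall x, 0 <= f x)%E -> (forall x, 0 <= g x)%E ->
  (forall x, G x -> f x <= g x)%E -> (\int[mu]_x f x <= \int[mu]_x g x)%E.
Proof.
move=> mG G0 f0 g0 fg; rewrite !ge0_integralTE//.
apply: ge_ereal_sup => _ [h hf <-].
(* Multiplying [h] by the indicator of [G] keeps its integral and brings it below [g] everywhere. *)
have -> : sintegral mu h = sintegral mu (proj_nnsfun h mG).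
  rewrite -!integralT_nnsfun (@ge0_negligible_integral _ _ _ _ setT (~` G))//.
  - rewrite setTD setCK integral_mkcond; apply: eq_integral => x _.
    rewrite patchE /= mindicE; case: ifPn => xG; first by rewrite mulr1.
    by rewrite mulr0.
  - exact: measurableC.
  - exact/measurable_EFinP.
  - by move=> x _; rewrite lee_fin.
apply: ereal_sup_ubound; exists (proj_nnsfun h mG) => // x /=.
rewrite mindicE; have [xG|xG] := boolP (x \in G); last by rewrite mulr0.
by rewrite mulr1 (le_trans (hf x))// fg// -inE.
Qed.

Lemma integral_eq_off_negligible mu (G : set T) (f g : T -> \bar R) :
  measurable G -> mu (~` G) = 0%E ->
  (forall x, 0 <= f x)%E -> (forall x, 0 <= g x)%E ->
  (forall x, G x -> f x = g x) -> (\int[mu]_x f x = \int[mu]_x g x)%E.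
Proof.
move=> mG G0 f0 g0 fg.
by apply/eqP; rewrite eq_le; apply/andP; split;
  apply: (@le_integral_off_negligible _ G) => // x /fg ->.
Qed.

Lemma integral_mrestr mu (D : set T) (mD : measurable D) (f : T -> \bar R) :
  (forall x, 0 <= f x)%E -> measurable_fun setT f ->
  (\int[mrestr mu mD]_x f x = \int[mu]_(x in D) f x)%E.
Proof.
move=> f0 mf; rewrite (@ge0_negligible_integral _ _ _ _ setT (~` D))//.
- rewrite setTD setCK; apply: eq_measure_integral => A mA AD.
  by rewrite /= /mrestr (_ : A `&` D = A)//; apply/setIidPl.
- exact: measurableC.
- by rewrite /= /mrestr setICl measure0.
Qed.

End IntegralFacts.

Section Plane.
Context (R : realType).

(** The measure of [leb2] under its own name, so that it can carry the sigma-finite measure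
    structure on [R * R] that Fubini asks for. *)
Definition leb_plane : set (R * R) -> \bar R :=
  (@lebesgue_measure R \x @lebesgue_measure R)%E.

Lemma leb_plane0 : leb_plane set0 = 0%E.
Proof. by rewrite /leb_plane measure0. Qed.

Lemma leb_plane_ge0 A : (0 <= leb_plane A)%E.
Proof. exact: measure_ge0. Qed.

Lemma leb_plane_sigma_additive : semi_sigma_additive leb_plane.
Proof.
exact: (@measure_semi_sigma_additive _ _ _
  (lebesgue_integral_fubini_product_measure1__canonical__measure_function_Measure
    (@lebesgue_measure R) (@lebesgue_measure R))).
Qed.

HB.instance Definition _ :=
  isMeasure.Build _ _ _ leb_plane leb_plane0 leb_plane_ge0 leb_plane_sigma_additive.

Lemma leb_plane_sigma_finite : sigma_finite setT leb_plane.
Proof.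
exists annulus; first by rewrite annulus_cover.
by move=> m; split; [exact: measurable_annulus|exact: leb2_annulus].
Qed.

HB.instance Definition _ :=
  Measure_isSigmaFinite.Build _ _ _ leb_plane leb_plane_sigma_finite.

End Plane.

(** * The Campbell measure and its identification *)

Section Mecke.
Context {R : realType} (lam : R) (hlam : 0 < lam).
Context (P : probability (Cfg R) R) (hP : is_poisson_law lam P).
Implicit Types (w : set (R * R)) (B C : set (R * R)).

(** Image of [kpiece] under [x |-> (w, x)], which remembers the configuration of each point. The
    [unit] component is the source of the constant kernel [P] with which it is composed. *)
Definition kpair m k : unit * Cfg R -> {measure set (Cfg R * (R * R)) -> \bar R} :=
  fun z => measure_function_pushforward__canonical__measure_function_Measure
    (kpiece m k z.2) (pair1_measurable z.2).

Lemma kpairE m k z U : kpair m k z U = kpiece m k z.2 (xsection U z.2).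
Proof.
by congr (kpiece _ _ _ _); apply/seteqP; split=> x; rewrite /xsection/= inE.
Qed.

Lemma measurable_kpair m k U : measurable U -> measurable_fun setT (kpair m k ^~ U).
Proof.
move=> mU; under eq_fun do rewrite kpairE.
have h : measurable_fun setT (fun w : Cfg R => kpiece m k w (xsection U w)).
  by apply: measurable_fun_xsection_finite_kernel; rewrite inE.
exact: (measurableT_comp h measurable_snd).
Qed.

HB.instance Definition _ m k := isKernel.Build _ _ (unit * Cfg R)%type
  (Cfg R * (R * R))%type R (kpair m k) (measurable_kpair m k).

Lemma kpair_uub m k : measure_fam_uub (kpair m k).
Proof. by have [r kr] := @kpiece_uub R m k; exists r => z; exact: kr. Qed.

HB.instance Definition _ m k := Kernel_isFinite.Build _ _ (unit * Cfg R)%type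
  (Cfg R * (R * R))%type R (kpair m k) (kpair_uub m k).

Definition kpairs : R.-sfker (unit * Cfg R)%type ~> (Cfg R * (R * R))%type :=
  kseries (fun m => kseries (fun k =>
    kpair m k : R.-sfker (unit * Cfg R)%type ~> (Cfg R * (R * R))%type)
    : R.-sfker (unit * Cfg R)%type ~> (Cfg R * (R * R))%type).

Lemma kpairsE z U : kpairs z U = kappa z.2 (xsection U z.2).
Proof.
by apply: eq_eseriesr => m _; apply: eq_eseriesr => k _; exact: kpairE.
Qed.

Definition kcst : R.-sfker unit ~> Cfg R :=
  kprobability (measurable_cst (P : pprobability (Cfg R) R)).

(** Campbell measure of the heads. As a composition of kernels it is countably additive and
    integrates iteratively by construction. *)
Definition campbell : {measure set (Cfg R * (R * R)) -> \bar R} :=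
  mkcomp kcst kpairs tt.

Lemma campbellE U : measurable U ->
  campbell U = (\int[P]_w npts (rho w) (xsection U w))%E.
Proof.
move=> mU; rewrite /campbell/= /kcomp; apply: eq_integral => w _.
by rewrite kpairsE/= kappaE//; exact: measurable_xsection.
Qed.

Lemma integral_campbell F : (forall z, 0 <= F z)%E -> measurable_fun setT F ->
  (\int[campbell]_z F z = \int[P]_w \int[kappa w]_x F (w, x))%E.
Proof.
move=> F0 mF; rewrite (integral_kcomp kcst kpairs)//; apply: eq_integral => w _ /=.
transitivity (\int[measure_function_pushforward__canonical__measure_function_Measure
    (kappa w) (pair1_measurable w)]_z F z)%E.
  apply: eq_measure_integral => U mU _; rewrite kpairsE/=; congr (kappa _ _).
  by apply/seteqP; split=> x; rewrite /xsection/= inE.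
by rewrite ge0_integral_pushforward.
Qed.

(** Adding [x] keeps [B] empty exactly when [w] avoids [B] and [x] is not in [B], so void events
    pull back to rectangles. *)
Lemma measurable_add_point :
  measurable_fun setT (fun z : Cfg R * (R * R) => (z.1 `|` [set z.2] : Cfg R)).
Proof.
apply: measurable_fun_Cfg => B mB.
rewrite (_ : [set _ | _] = [set w : Cfg R | w `&` B = set0] `*` ~` B).
  apply: measurableX; [exact: measurable_void|exact: measurableC].
apply/seteqP; split=> -[w x] /=.
  move=> wx0; split; last by move=> Bx;
    suff : set0 x by []; rewrite -[set0]wx0; split=> //; right.
  by apply/seteqP; split=> // y [wy By]; rewrite -wx0; split=> //; left.
move=> [w0 nBx]; apply/seteqP; split=> // y [[wy|->]//] By.
by rewrite -w0.
Qed.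

Lemma measurable_mark_point :
  measurable_fun setT (fun z : Cfg R * (R * R) => ((z.1 `|` [set z.2] : Cfg R), z.2)).
Proof.
exact: (measurable_fun_pair measurable_add_point measurable_snd).
Qed.

(** The right side of the Mecke formula as a measure, which turns the formula into an equality of
    two measures that can be tested on a pi-system. *)
Definition mecke_measure : {measure set (Cfg R * (R * R)) -> \bar R} :=
  mscale (NngNum (ltW (mulr_gt0 (ltr0Sn R 1) hlam)))
   (mrestr (measure_function_pushforward__canonical__measure_function_Measure
     (lebesgue_integral_fubini_product_measure1__canonical__measure_function_Measure
       P (leb_plane R)) measurable_mark_point)
     (measurableX measurableT (@measurable_Hplus R))).

Lemma integral_mecke_measure F : (forall z, 0 <= F z)%E -> measurable_fun setT F ->
  (\int[mecke_measure]_z F z =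
   (2 * lam)%:E * \int[leb_plane R]_(x in @Hplus R) \int[P]_w F (w `|` [set x], x))%E.
Proof.
move=> F0 mF; rewrite ge0_integral_mscale// integral_mrestr//; congr (_ * _)%E.
rewrite ge0_integral_pushforward//; last 2 first.
- by apply: measurableX => //; exact: measurable_Hplus.
- exact: measurable_funTS.
have mH : measurable ([set: Cfg R] `*` @Hplus R).
  by apply: measurableX => //; exact: measurable_Hplus.
rewrite integral_mkcond fubini_tonelli2//; last 2 first.
- apply/(measurable_restrictT _ _).1.
    rewrite -[X in measurable X]setTI; exact: measurable_mark_point.
  by apply: measurable_funTS; apply: measurableT_comp => //; exact: measurable_mark_point.
- by apply: erestrict_ge0 => z _; exact: F0.
rewrite [RHS]integral_mkcond; apply: eq_integral => x _.
rewrite patchE; case: ifPn => [xH|xH].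
  apply: eq_integral => w _; rewrite patchE /=; case: ifPn => // /negP[].
  by move: xH; rewrite !inE.
apply: integral0_eq => w _; rewrite patchE; case: ifPn => //.
by move: xH; rewrite inE notin_setE /= => nH [].
Unshelve. exact: measurable_mark_point.
Qed.

Lemma mecke_measure_rect B C : measurable B -> measurable C ->
  mecke_measure ([set w : Cfg R | w `&` B = set0] `*` C) =
  (P [set w : Cfg R | w `&` B = set0] * intens lam (C `\` B))%E.
Proof.
move=> mB mC; rewrite /mecke_measure /= /mscale /= /mrestr /= /pushforward.
have -> : (fun z : Cfg R * (R * R) => ((z.1 `|` [set z.2] : Cfg R), z.2)) @^-1`
    ([set w : Cfg R | w `&` B = set0] `*` C `&` [set: Cfg R] `*` @Hplus R) =
    [set w : Cfg R | w `&` B = set0] `*` ((C `\` B) `&` @Hplus R).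
  apply/seteqP; split=> -[w x] /=.
    move=> [[wx0 Cx] [_ Hx]]; split.
      by apply/seteqP; split=> // y [wy By]; rewrite -[set0]wx0; split=> //; left.
    split=> //; split=> // Bx; suff : set0 x by [].
    by rewrite -[set0]wx0; split=> //; right.
  move=> [w0 [[Cx nBx] Hx]]; split=> //; split=> //.
  by apply/seteqP; split=> // y [[wy|->]//] By; rewrite -[set0]w0.
rewrite product_measure1E; [|exact: measurable_void|].
  by rewrite /intens muleCA.
by apply: measurableI; [exact: measurableD|exact: measurable_Hplus].
Qed.

(** Under the expectation it suffices to argue for good configurations, where [rho w] is [w]. *)
Lemma integral_good (f g : Cfg R -> \bar R) :
  (forall w, 0 <= f w)%E -> (forall w, 0 <= g w)%E ->
  (forall w, good w -> f w = g w) -> (\int[P]_w f w = \int[P]_w g w)%E.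
Proof.
move=> f0 g0; apply: (@integral_eq_off_negligible _ _ _ P [set w : Cfg R | good w]) => //.
  exact: measurable_good.
exact: (negligible_bad _ hlam _ hP).
Qed.

(* Off [B] the counts of [C] and [B] are independent, which is all that the
   Mecke formula says on rectangles of void events. *)
Lemma campbell_rect B C : measurable B -> (intens lam B < +oo)%E ->
  measurable C -> (intens lam C < +oo)%E ->
  campbell ([set w : Cfg R | w `&` B = set0] `*` C) =
  (P [set w : Cfg R | w `&` B = set0] * intens lam (C `\` B))%E.
Proof.
move=> mB fB mC fC; have mCB : measurable (C `\` B) by exact: measurableD.
have fCB : (intens lam (C `\` B) < +oo)%E.
  by apply: le_lt_trans fC; apply: intens_le => // x [].
rewrite (prob_void _ _ hP _ mB fB) muleC -(mean_count_void _ hlam _ hP _ _ mCB fCB mB fB); last first.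
  by rewrite setDE -setIA setICl setI0.
rewrite campbellE; last by apply: measurableX => //; exact: measurable_void.
rewrite [RHS]integral_mkcond; apply: integral_good.
- by move=> w; exact: npts_ge0.
- by move=> w; apply: erestrict_ge0 => ? _; exact: npts_ge0.
move=> w gw; rewrite rho_good// patchE; case: ifPn => [wB|wB].
  rewrite in_xsectionX//; apply/eqP.
  have w0 : w `&` B = set0 by move: wB; rewrite inE.
  rewrite eq_le; apply/andP; split; apply: esum_subset => x [wx].
    move=> Cx; split=> //; split=> // Bx; suff : set0 x by [].
    by rewrite -[set0]w0.
  by move=> [].
by rewrite notin_xsectionX// npts_set0.
Qed.

(** Both sides have finite intensity because the Poisson law is specified on such sets; cutting
    along annuli recovers all Borel sets. *)
Definition rect_gen : set (set (Cfg R * (R * R))) :=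
  [set S | exists B C, [/\ measurable B, (intens lam B < +oo)%E, measurable C,
     (intens lam C < +oo)%E & S = [set w : Cfg R | w `&` B = set0] `*` C]].

Lemma rect_gen_measurable : rect_gen `<=` measurable.
Proof.
move=> _ [B [C [mB _ mC _ ->]]].
by apply: measurableX => //; exact: measurable_void.
Qed.

(** For a fixed [D] of finite intensity, the events [A] for which the rectangle over [D] is
    generated form a sigma-algebra that contains the void events. *)
Lemma rect_genE : (@measurable _ (Cfg R * (R * R))%type) = <<s rect_gen >>.
Proof.
apply/seteqP; split; last first.
  by apply: smallest_sub; [exact: sigma_algebra_measurable|exact: rect_gen_measurable].
rewrite measurable_prod_measurableType; apply: smallest_sub.
  exact: smallest_sigma_algebra.
move=> _ [A mA [C mC <-]].
have [S0 SC SU] := smallest_sigma_algebra setT rect_gen.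
have gT C' : measurable C' -> (intens lam C' < +oo)%E -> <<s rect_gen >> (setT `*` C').
  move=> mC' fC'; apply: sub_sigma_algebra; exists set0, C'; split=> //.
    by rewrite /intens set0I /leb2 measure0 mule0.
  by congr (_ `*` _); apply/seteqP; split=> w // _; exact: setI0.
have SI X Y : <<s rect_gen >> X -> <<s rect_gen >> Y -> <<s rect_gen >> (X `\` Y).
  exact: (@measurableD _ (g_sigma_algebraType rect_gen)).
have key m : <<s rect_gen >> (A `*` (C `&` annulus m)).
  set D := C `&` annulus m.
  have mD : measurable D by apply: measurableI => //; exact: measurable_annulus.
  have fD : (intens lam D < +oo)%E by exact: intens_annulusI.
  move: A mA; rewrite Cfg_void_gen; apply: smallest_sub.
    split=> /=.
    - by rewrite set0X.
    - move=> X hX; rewrite (_ : _ `*` _ = (setT `*` D) `\` (X `*` D)).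
        by apply: SI => //; exact: gT.
      apply/seteqP; split=> -[w x] /= [].
        by move=> [_ nX] Dx; split=> // -[].
      by move=> [_ Dx] nX; split=> //; split=> // Xw; apply: nX.
    - by move=> F hF; rewrite setX_bigcupl; exact: SU.
  move=> _ [B mB <-] /=.
  (* A void event is the intersection of the void events of the traces of [B] on the annuli, written
     here with complements relative to [D]. *)
  rewrite (_ : _ `*` _ = (setT `*` D) `\` \bigcup_n ((setT `*` D) `\`
     ([set w : Cfg R | w `&` (B `&` annulus n) = set0] `*` D))).
    apply: (SI); first exact: gT.
    apply: SU => n; apply: SI; first exact: gT.
    apply: sub_sigma_algebra; exists (B `&` annulus n), D; split=> //.
      by apply: measurableI => //; exact: measurable_annulus.
    exact: intens_annulusI.
  apply/seteqP; split=> -[w x] /=.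
    move=> [wB Dx]; split=> // -[n _ [_ /=]]; apply; split=> //.
    by apply/seteqP; split=> // y [wy [By _]]; rewrite -[set0]wB.
  move=> [[_ Dx] h]; split=> //; apply/seteqP; split=> // y [wy By].
  have [n _ ny] : (\bigcup_n annulus n) y by rewrite annulus_cover.
  apply: contrapT => _; apply: h; exists n => //; split=> //= -[w0 _].
  suff : set0 y by []; by rewrite -[set0]w0.
rewrite -[C]setIT -annulus_cover setI_bigcupr setX_bigcupr; exact: SU.
Qed.

Lemma rect_gen_setI : setI_closed rect_gen.
Proof.
move=> _ _ [B [C [mB fB mC fC ->]]] [B' [C' [mB' fB' mC' fC' ->]]].
exists (B `|` B'), (C `&` C'); split.
- exact: measurableU.
- exact: intens_setU.
- exact: measurableI.
- by apply: le_lt_trans fC; apply: intens_le => //; exact: measurableI.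
by rewrite -setXI voidU.
Qed.

Lemma campbell_meckeE S : measurable S -> campbell S = mecke_measure S.
Proof.
apply: (measure_unique rect_gen (fun m => setT `*` annulus m)).
- exact: rect_genE.
- exact: rect_gen_setI.
(* The whole space is the void event of the empty set, so the exhausting sets belong to the
   generator. *)
- move=> m; exists set0, (annulus m); split=> //.
  + by rewrite /intens set0I /leb2 measure0 mule0.
  + exact: measurable_annulus.
  + exact: intens_annulus.
  + by congr (_ `*` _); apply/seteqP; split=> w // _; exact: setI0.
- by rewrite -setX_bigcupr annulus_cover setXTT.
- by move=> _ [B [C [mB fB mC fC ->]]]; rewrite campbell_rect// mecke_measure_rect.
move=> m; rewrite (_ : setT = [set w : Cfg R | w `&` set0 = set0]).
  rewrite campbell_rect//.
  - by rewrite setD0 (_ : [set _ | _] = setT) ?probability_setT ?mul1e ?intens_annulus//;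
      apply/seteqP; split=> w // _; exact: setI0.
  - by rewrite /intens set0I /leb2 measure0 mule0.
  - exact: measurable_annulus.
  - exact: intens_annulus.
by apply/seteqP; split=> w // _; exact: setI0.
Qed.

Theorem mecke F : (forall z, 0 <= F z)%E -> measurable_fun setT F ->
  (\int[P]_w \int[kappa w]_x F (w, x) =
   (2 * lam)%:E * \int[leb_plane R]_(x in @Hplus R) \int[P]_w F (w `|` [set x], x))%E.
Proof.
move=> F0 mF; rewrite -integral_campbell// -integral_mecke_measure//.
by apply: eq_measure_integral => S mS _; exact: campbell_meckeE.
Qed.

End Mecke.

(** * Shifts and stationarity *)

Section Substitution.
Context {R : realType}.

Lemma measurable_affine (a b : R) : measurable_fun setT (fun x : R => a * x + b).
Proof. by apply: measurable_funD => //; exact: measurable_funM. Qed.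

(** The scaled image measure gives half-open intervals their length, and Lebesgue measure is the
    only one that does. *)
Lemma lebesgue_affine (a b : R) (A : set R) : 0 < a -> measurable A ->
  (a%:E * lebesgue_measure ((fun x => a * x + b)%R @^-1` A) = lebesgue_measure A)%E.
Proof.
move=> a0; have maff : measurable_fun setT
    ((fun x => a * x + b) : measurableTypeR R -> measurableTypeR R).
  exact: measurable_affine.
pose m := mscale (NngNum (ltW a0))
  (measure_function_pushforward__canonical__measure_function_Measure
    (@lebesgue_measure R) maff).
move=> mA; apply/esym; apply: (@lebesgue_measure_unique _ m) => // X.
move=> -[[u v] _ <-] /=.
rewrite /m /= /mscale /= /pushforward /=.
rewrite (_ : _ @^-1` _ = `](u - b) / a, (v - b) / a]%classic); last first.
  apply/seteqP; split=> x /=; rewrite !in_itv/= ltr_pdivrMr// ler_pdivlMr// ltrBlDr lerBrDr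
    [x * a]mulrC//.
rewrite !lebesgue_measure_itv/= !lte_fin ltr_pM2r ?invr_gt0// ltrD2r.
case: ifPn => _; last by rewrite mule0.
by rewrite -!EFinB -EFinM; congr EFin; field; rewrite gt_eqF.
Qed.

Lemma integral_affine (a b : R) (g : R -> \bar R) : 0 < a ->
  (forall x, 0 <= g x)%E -> measurable_fun setT g ->
  (\int[lebesgue_measure]_x g (a * x + b)%R = (a^-1)%:E * \int[lebesgue_measure]_x g x)%E.
Proof.
move=> a0 g0 mg; have maff : measurable_fun setT
    ((fun x => a * x + b) : measurableTypeR R -> measurableTypeR R).
  exact: measurable_affine.
transitivity (\int[measure_function_pushforward__canonical__measure_function_Measure
    (@lebesgue_measure R) maff]_x g x)%E.
  by rewrite ge0_integral_pushforward.
have ia0 : 0 <= a^-1 by rewrite invr_ge0 ltW.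
rewrite -(ge0_integral_mscale _ measurableT (NngNum ia0))//.
apply: eq_measure_integral => A mA _.
rewrite /= /mscale /= /pushforward -[in RHS](lebesgue_affine a b A)//.
by rewrite muleA -EFinM mulVf ?mul1e// gt_eqF.
Qed.

Lemma integral_translate (b : R) (g : R -> \bar R) :
  (forall x, 0 <= g x)%E -> measurable_fun setT g ->
  (\int[lebesgue_measure]_x g (x + b)%R = \int[lebesgue_measure]_x g x)%E.
Proof.
move=> g0 mg; have := @integral_affine 1 b g ltr01 g0 mg.
by rewrite invr1 mul1e => <-; apply: eq_integral => x _; rewrite mul1r.
Qed.

Lemma integral_reflect (g : R -> \bar R) :
  (forall x, 0 <= g x)%E -> measurable_fun setT g ->
  (\int[lebesgue_measure]_x g (- x)%R = \int[lebesgue_measure]_x g x)%E.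
Proof.
move=> g0 mg; have mopp : measurable_fun setT
    (-%R : measurableTypeR R -> measurableTypeR R) by exact: oppr_measurable.
transitivity (\int[measure_function_pushforward__canonical__measure_function_Measure
    (@lebesgue_measure R) mopp]_x g x)%E.
  by rewrite ge0_integral_pushforward.
by apply: eq_measure_integral => A mA _; exact: lebesgue_measureN.
Qed.

Lemma leb_plane_translate (s : R) (B : set (R * R)) : measurable B ->
  leb_plane R [set p | B (p.1 - s, p.2)] = leb_plane R B.
Proof.
move=> mB; rewrite /leb_plane /product_measure1.
rewrite -[RHS](@integral_translate (- s)).
- exact: eq_integral.
- by move=> x; exact: measure_ge0.
- exact: (measurable_fun_xsection (@lebesgue_measure R)).
Qed.

End Substitution.

Section Theta.
Context {R : realType}.
Implicit Types (w : set (R * R)) (B : set (R * R)).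

Lemma theta_void s w B : theta s w `&` B = set0 <->
  w `&` [set p | B (p.1 - s, p.2)] = set0.
Proof.
split=> h; apply/seteqP; split=> // -[a b] [].
  move=> wab Bab; suff : set0 (a - s, b) by [].
  by rewrite -[set0]h; split=> //; rewrite /theta/= subrK.
rewrite /theta/= => wab Bab; suff : set0 (a + s, b) by [].
by rewrite -[set0]h; split=> //=; rewrite addrK.
Qed.

Lemma theta_theta s t w : theta s (theta t w) = theta (s + t) w.
Proof. by apply/seteqP; split=> -[a b]; rewrite /theta/= addrA. Qed.

Lemma theta_setU1 s w (p : R * R) :
  theta s (w `|` [set p]) = theta s w `|` [set (p.1 - s, p.2)].
Proof.
case: p => a b; apply/seteqP; split=> -[c d]; rewrite /theta/=.
  by move=> [|[<- <-]]; [left|right; rewrite addrK].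
by move=> [|[-> ->]]; [left|right; rewrite subrK].
Qed.

Lemma measurable_shift_plane (s : R) B : measurable B ->
  measurable [set p : R * R | B (p.1 - s, p.2)].
Proof.
move=> mB; rewrite -[X in measurable X]setTI.
have h : measurable_fun setT (fun p : R * R => (p.1 - s, p.2)).
  by apply: measurable_fun_pair => //; exact: measurable_funB.
exact: h.
Qed.

Lemma measurable_theta s : measurable_fun setT (theta s : Cfg R -> Cfg R).
Proof.
apply: measurable_fun_Cfg => B mB.
rewrite (_ : [set _ | _] = [set w : Cfg R | w `&` [set p | B (p.1 - s, p.2)] = set0]).
  by apply: measurable_void; exact: measurable_shift_plane.
by apply/seteqP; split=> w; [exact: (theta_void s w B).1|exact: (theta_void s w B).2].
Qed.

Lemma measurable_setU1 (p : R * R) :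
  measurable_fun setT (fun w : Cfg R => w `|` [set p] : Cfg R).
Proof. exact: (measurable_fun_pair1 p (@measurable_add_point R)). Qed.

End Theta.

Section Stationarity.
Context {R : realType} (lam : R) (hlam : 0 < lam).
Context (P : probability (Cfg R) R) (hP : is_poisson_law lam P).

Lemma intens_translate (s : R) (B : set (R * R)) : measurable B ->
  intens lam [set p | B (p.1 - s, p.2)] = intens lam B.
Proof.
move=> mB; rewrite /intens; congr (_ * _)%E.
have mBH : measurable (B `&` @Hplus R).
  by apply: measurableI => //; exact: measurable_Hplus.
exact: (leb_plane_translate s (B `&` @Hplus R) mBH).
Qed.

Definition void_fin_gen : set (set (Cfg R)) :=
  [set A | exists B, [/\ measurable B, (intens lam B < +oo)%E &
    A = [set w : Cfg R | w `&` B = set0]]].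

Lemma void_fin_genE : (@measurable _ (Cfg R)) = <<s void_fin_gen >>.
Proof.
apply/seteqP; split; last first.
  apply: smallest_sub; first exact: sigma_algebra_measurable.
  by move=> _ [B [mB _ ->]]; exact: measurable_void.
rewrite Cfg_void_gen; apply: smallest_sub; first exact: smallest_sigma_algebra.
move=> _ [B mB <-].
rewrite (_ : [set _ | _] =
    \bigcap_m [set w : Cfg R | w `&` (B `&` annulus m) = set0]).
  apply: (@bigcapT_measurable _ (g_sigma_algebraType void_fin_gen)) => m.
  apply: sub_sigma_algebra; exists (B `&` annulus m); split=> //.
    by apply: measurableI => //; exact: measurable_annulus.
  exact: intens_annulusI.
apply/seteqP; split=> w /=.
  by move=> w0 m _ /=; rewrite setIA w0 set0I.
move=> wm; rewrite -[B]setIT -annulus_cover setI_bigcupr setI_bigcupr.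
by apply: bigcup0 => m _; exact: wm.
Qed.

Lemma void_fin_gen_setI : setI_closed void_fin_gen.
Proof.
move=> _ _ [B [mB fB ->]] [B' [mB' fB' ->]]; exists (B `|` B'); split.
- exact: measurableU.
- exact: intens_setU.
exact: voidU.
Qed.

(** Void events of finite intensity form a generating pi-system, so void probabilities determine the
    law; they depend only on the intensity, which horizontal translations preserve. *)
Lemma stationary (s : R) (A : set (Cfg R)) : measurable A -> P (theta s @^-1` A) = P A.
Proof.
pose m : {measure set (Cfg R) -> \bar R} :=
  measure_function_pushforward__canonical__measure_function_Measure P (measurable_theta s).
move=> mA; apply: esym; move: A mA.
apply: (measure_unique void_fin_gen (fun=> setT) _ _ _ _ P m).
- exact: void_fin_genE.
- exact: void_fin_gen_setI.
- move=> _; exists set0; split=> //; first by rewrite /intens set0I /leb2 measure0 mule0.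
  by apply/seteqP; split=> w // _; exact: setI0.
- exact: bigcup_const.
- move=> _ [B [mB fB ->]].
  transitivity (expR (- fine (intens lam B)))%:E.
    exact: (prob_void _ _ hP).
  rewrite -(intens_translate s B mB) -(prob_void _ _ hP); last 2 first.
  - exact: measurable_shift_plane.
  - by rewrite intens_translate.
  rewrite /m /= /pushforward; congr (P _).
  by apply/seteqP; split=> w; [exact: (theta_void s w B).2|exact: (theta_void s w B).1].
- by move=> _; apply: (@le_lt_trans _ _ 1%E); [exact: probability_le1|exact: ltry].
Qed.

Lemma integral_stationary (s : R) (g : Cfg R -> \bar R) : (forall w, 0 <= g w)%E ->
  measurable_fun setT g -> (\int[P]_w g (theta s w) = \int[P]_w g w)%E.
Proof.
move=> g0 mg.
transitivity (\int[measure_function_pushforward__canonical__measure_function_Measure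
    P (measurable_theta s)]_w g w)%E.
  by rewrite (ge0_integral_pushforward (measurable_theta s)).
by apply: eq_measure_integral => A mA _; exact: stationary.
Qed.

End Stationarity.

(** * Joint measurability in the configuration and a parameter *)

Section JointMeasurability.
Context {R : realType}.
Implicit Types (w : set (R * R)) (B : set (R * R)).
Context d (T : measurableType d) (phi : T -> Cfg R).

(** [mphi] is carried as an argument because the kernel structure attached to this constant is built
    from it. *)
Definition kpiece_comp (mphi : measurable_fun setT phi) m k :
  T -> {measure set (R * R) -> \bar R} := fun t => kpiece m k (phi t).

Hypothesis mphi : measurable_fun setT phi.

Lemma measurable_kpiece_comp m k U : measurable U ->
  measurable_fun setT (kpiece_comp mphi m k ^~ U).
Proof. by move=> mU; exact: measurableT_comp (measurable_kpiece m k U mU) mphi. Qed.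

HB.instance Definition _ m k := isKernel.Build _ _ T (R * R)%type R
  (kpiece_comp mphi m k) (measurable_kpiece_comp m k).

Lemma kpiece_comp_uub m k : measure_fam_uub (kpiece_comp mphi m k).
Proof. by have [r kr] := @kpiece_uub R m k; exists r => t; exact: kr. Qed.

HB.instance Definition _ m k := Kernel_isFinite.Build _ _ T (R * R)%type R
  (kpiece_comp mphi m k) (kpiece_comp_uub m k).

Definition kappa_comp : R.-sfker T ~> (R * R)%type :=
  kseries (fun m => kseries (fun k =>
    kpiece_comp mphi m k : R.-sfker T ~> (R * R)%type) : R.-sfker T ~> (R * R)%type).

Lemma measurable_integral_kappa (F : T * (R * R) -> \bar R) :
  (forall z, 0 <= F z)%E -> measurable_fun setT F ->
  measurable_fun setT (fun t => \int[kappa (phi t)]_x F (t, x))%E.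
Proof.
move=> F0 mF; have := measurable_fun_integral_sfinite_kernel F kappa_comp F0 mF.
congr (measurable_fun _ _).
Qed.

(** A section is avoided when the sum of its indicator over the points is 0, and that sum is a
    kernel integral, measurable in [t] although the avoided set moves with [t]. *)
Lemma measurable_void_section (S : set (T * (R * R))) : measurable S ->
  measurable [set t | rho (phi t) `&` [set x | S (t, x)] = set0].
Proof.
move=> mS; pose F z : \bar R := (\1_S z)%:E.
have mF : measurable_fun setT F by exact/measurable_EFinP/measurable_indic.
have F0 z : (0 <= F z)%E by rewrite lee_fin.
have := measurable_integral_kappa F F0 mF measurableT [set 0%E] (emeasurable_set1 _).
rewrite setTI; congr (measurable _); apply/seteqP; split=> t /=; rewrite integral_kappa//.
- move=> e0; apply/seteqP; split=> // x [rx Sx].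
  have : (\esum_(y in [set x]) F (t, y) <= \esum_(y in rho (phi t)) F (t, y))%E.
    by apply: esum_subset => // y ->.
  by rewrite e0 esum_set1// /F indicE mem_set// lee_fin ler10.
- exact: measurableT_comp.
- move=> v; apply: esum1 => x rx; rewrite /F indicE memNset// => Sx.
  by suff : set0 x by []; rewrite -[set0]v.
- exact: measurableT_comp.
Qed.

(** Avoiding [B] after a shift by [s t] is avoiding a translate of [B] that moves with [t]. *)
Lemma measurable_theta_rho (s : T -> R) : measurable_fun setT s ->
  measurable_fun setT (fun t => theta (s t) (rho (phi t)) : Cfg R).
Proof.
move=> ms; apply: measurable_fun_Cfg => B mB.
rewrite (_ : [set _ | _] =
    [set t | rho (phi t) `&` [set x | [set z : T * (R * R) | B (z.2.1 - s z.1, z.2.2)] (t, x)] = set0]).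
  apply: measurable_void_section; rewrite -[X in measurable X]setTI.
  have h : measurable_fun setT (fun z : T * (R * R) => (z.2.1 - s z.1, z.2.2)).
    apply: measurable_fun_pair.
      apply: measurable_funB; first exact: (measurableT_comp measurable_fst measurable_snd).
      exact: (measurableT_comp ms measurable_fst).
    exact: (measurableT_comp measurable_snd measurable_snd).
  exact: h.
by apply/seteqP; split=> t;
  [exact: (theta_void (s t) (rho (phi t)) B).1|exact: (theta_void (s t) (rho (phi t)) B).2].
Qed.

End JointMeasurability.

(** * Crossings of birds *)

Set Implicit Arguments.
Unset Strict Implicit.

Section BirdPairs.
Context {R : realType}.
Implicit Types (w : set (R * R)) (x y z : R * R).

Definition pairs x y : R := shat x.1 x.2 y.1 y.2.
Definition pairr x y : R := hhat x.1 x.2 y.1 y.2.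

Lemma hhat2_ge0 x y : 0 <= hhat2 x.1 x.2 y.1 y.2.
Proof.
rewrite /hhat2 mulr_ge0// addr_ge0//; last by rewrite divr_ge0// sqr_ge0.
by rewrite addr_ge0 ?sqr_ge0// mulr_ge0// addr_ge0// sqr_ge0.
Qed.

Lemma sqr_pairr x y : pairr x y ^+ 2 = hhat2 x.1 x.2 y.1 y.2.
Proof. by rewrite /pairr /hhat sqr_sqrtr// hhat2_ge0. Qed.

(** Together with [pairr_r]: both heads lie on the circle bounding the disk of their crossing, since
    both birds pass through it. *)
Lemma pairr_l x y : x.1 != y.1 -> pairr x y ^+ 2 = (x.1 - pairs x y) ^+ 2 + x.2 ^+ 2.
Proof.
rewrite -subr_eq0 => xy; rewrite sqr_pairr /hhat2 /pairs /shat; field.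
by rewrite xy.
Qed.

Lemma pairr_r x y : x.1 != y.1 -> pairr x y ^+ 2 = (y.1 - pairs x y) ^+ 2 + y.2 ^+ 2.
Proof.
rewrite -subr_eq0 => xy; rewrite sqr_pairr /hhat2 /pairs /shat; field.
by rewrite xy.
Qed.

Lemma pairs_sym x y : pairs x y = pairs y x.
Proof.
(* For equal abscissae the inverse of the zero denominator is 0 and so are both sides. *)
rewrite /pairs /shat; have [e|ne] := eqVneq x.1 y.1; first by rewrite e subrr mulr0 invr0 !mulr0.
have h1 : x.1 - y.1 != 0 by rewrite subr_eq0.
have h2 : y.1 - x.1 != 0 by rewrite subr_eq0 eq_sym.
by field; rewrite h1 h2.
Qed.

Lemma pairr_sym x y : pairr x y = pairr y x.
Proof.
rewrite /pairr /hhat /hhat2; congr Num.sqrt; congr (_ * _).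
have [e|ne] := eqVneq x.1 y.1; first by rewrite e subrr expr0n/= invr0 !mulr0; ring.
have h1 : x.1 - y.1 != 0 by rewrite subr_eq0.
have h2 : y.1 - x.1 != 0 by rewrite subr_eq0 eq_sym.
by field; rewrite h1 h2.
Qed.

(* Ordering the two heads by abscissa makes every crossing be counted once. *)
Definition crossing w x y : Prop :=
  [/\ y.1 < x.1, 0 <= pairs x y <= 1 & w `&` Udisk (pairs x y) (pairr x y) = set0].

Lemma measurable_fun_coord d (T : measurableType d) (f : T -> R * R) :
  measurable_fun setT f ->
  measurable_fun setT (fun t => (f t).1) /\ measurable_fun setT (fun t => (f t).2).
Proof.
by move=> mf; split; [exact: measurableT_comp measurable_fst mf|
  exact: measurableT_comp measurable_snd mf].
Qed.

Lemma measurable_invr : measurable_fun setT (fun u : R => u^-1).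
Proof.
rewrite -(setUv [set 0 : R]); apply/measurable_funU => //; first exact: measurableC.
split.
  exact: measurable_fun_set1.
apply: open_continuous_measurable_fun.
  by rewrite openC; exact: closed_eq.
by move=> u; rewrite inE /= => /eqP u0; exact: inv_continuous.
Qed.

Lemma measurable_pairs d (T : measurableType d) (f g : T -> R * R) :
  measurable_fun setT f -> measurable_fun setT g ->
  measurable_fun setT (fun t => pairs (f t) (g t)).
Proof.
move=> /measurable_fun_coord[f1 f2] /measurable_fun_coord[g1 g2].
apply: measurable_funM.
  apply: measurable_funB; last exact: measurable_funX.
  apply: measurable_funB; last exact: measurable_funX.
  by apply: measurable_funD; exact: measurable_funX.
apply: (measurableT_comp measurable_invr); apply: measurable_funM => //.
exact: measurable_funB.
Qed.

(** The square is all that [Udisk] sees of the radius, and it is rational in the coordinates. *)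
Lemma measurable_sqr_pairr d (T : measurableType d) (f g : T -> R * R) :
  measurable_fun setT f -> measurable_fun setT g ->
  measurable_fun setT (fun t => pairr (f t) (g t) ^+ 2).
Proof.
move=> /measurable_fun_coord[f1 f2] /measurable_fun_coord[g1 g2].
under eq_fun do rewrite sqr_pairr /hhat2.
apply: measurable_funM => //; apply: measurable_funD.
  apply: measurable_funD; first by apply: measurable_funX; exact: measurable_funB.
  by apply: measurable_funM => //; apply: measurable_funD; exact: measurable_funX.
apply: measurable_funM; first by apply: measurable_funX; apply: measurable_funB; exact: measurable_funX.
by apply: (measurableT_comp measurable_invr); apply: measurable_funX; exact: measurable_funB.
Qed.

Lemma measurable_ltr_set d (T : measurableType d) (f g : T -> R) :
  measurable_fun setT f -> measurable_fun setT g -> measurable [set t | f t < g t].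
Proof.
move=> mf mg; have := measurable_fun_ltr mf mg measurableT.
by move=> /(_ [set true]); rewrite setTI; apply.
Qed.

Lemma measurable_ler_set d (T : measurableType d) (f g : T -> R) :
  measurable_fun setT f -> measurable_fun setT g -> measurable [set t | f t <= g t].
Proof.
move=> mf mg; have := measurable_fun_ler mf mg measurableT.
by move=> /(_ [set true]); rewrite setTI; apply.
Qed.

Lemma measurable_eqr_set d (T : measurableType d) (f g : T -> R) :
  measurable_fun setT f -> measurable_fun setT g -> measurable [set t | f t = g t].
Proof.
move=> mf mg; rewrite (_ : [set _ | _] = [set t | f t <= g t] `&` [set t | g t <= f t]).
  by apply: measurableI; exact: measurable_ler_set.
apply/seteqP; split=> t /=; first by move=> ->; rewrite lexx.
by move=> [fg gf]; apply/eqP; rewrite eq_le fg.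
Qed.

Lemma measurable_empty_disk d (T : measurableType d) (phi : T -> Cfg R) (f g : T -> R * R) :
  measurable_fun setT phi -> measurable_fun setT f -> measurable_fun setT g ->
  measurable [set t | rho (phi t) `&` Udisk (pairs (f t) (g t)) (pairr (f t) (g t)) = set0].
Proof.
move=> mphi mf mg.
apply: (@measurable_void_section _ _ _ _ mphi
  [set z : T * (R * R) | Udisk (pairs (f z.1) (g z.1)) (pairr (f z.1) (g z.1)) z.2]).
have mz2 : measurable_fun setT (fun z : T * (R * R) => z.2) by exact: measurable_snd.
have [m1 m2] := measurable_fun_coord mz2.
have mf1 := measurableT_comp mf (@measurable_fst _ _ T (R * R)%type).
have mg1 := measurableT_comp mg (@measurable_fst _ _ T (R * R)%type).
apply: measurableI; first exact: measurable_ltr_set.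
apply: measurable_ltr_set; last exact: measurable_sqr_pairr.
apply: measurable_funD; last exact: measurable_funX.
by apply: measurable_funX; apply: measurable_funB => //; exact: measurable_pairs.
Qed.

Lemma measurable_crossing d (T : measurableType d) (phi : T -> Cfg R) (f g : T -> R * R) :
  measurable_fun setT phi -> measurable_fun setT f -> measurable_fun setT g ->
  measurable [set t | crossing (rho (phi t)) (f t) (g t)].
Proof.
move=> mphi mf mg; have [f1 f2] := measurable_fun_coord mf.
have [g1 g2] := measurable_fun_coord mg; have mp := measurable_pairs mf mg.
rewrite (_ : [set _ | _] = [set t | (g t).1 < (f t).1] `&`
  ([set t | 0 <= pairs (f t) (g t)] `&` [set t | pairs (f t) (g t) <= 1]) `&`
  [set t | rho (phi t) `&` Udisk (pairs (f t) (g t)) (pairr (f t) (g t)) = set0]).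
  apply: measurableI; last exact: measurable_empty_disk.
  apply: measurableI; first exact: measurable_ltr_set.
  by apply: measurableI; apply: measurable_ler_set.
apply/seteqP; split=> t /=; first by move=> [-> /andP[-> ->] ->].
by move=> [[h1 [h2 h3]] h4]; split=> //; rewrite h2 h3.
Qed.

End BirdPairs.

(** * Handovers as crossings of ordered pairs of heads *)

Section HandoverSum.
Context {R : realType}.
Implicit Types (w : set (R * R)) (x y z : R * R).

(* Three heads on a common circle centred on the axis would let one handover
   arise from several pairs. *)
Definition cocyclic x y z : Prop :=
  [/\ y.1 < x.1, z <> x, z <> y & (z.1 - pairs x y) ^+ 2 + z.2 ^+ 2 = pairr x y ^+ 2].

Definition generic w : Prop :=
  forall x y z, w x -> w y -> w z -> ~ cocyclic x y z.

Lemma handoverE w : handover w `&` [set s : R | 0 <= s <= 1] =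
  (fun p => pairs p.1 p.2) @` [set p | w p.1 /\ w p.2 /\ crossing w p.1 p.2].
Proof.
apply/seteqP; split.
  move=> s [[t1 [h1 [t2 [h2 [w1 [w2 [t12 [sE U0]]]]]]]] s01] /=.
  have {}sE : pairs (t1, h1) (t2, h2) = s by rewrite sE.
  have {}U0 : w `&` Udisk (pairs (t1, h1) (t2, h2)) (pairr (t1, h1) (t2, h2)) = set0.
    by rewrite sE.
  have {}s01 : 0 <= pairs (t1, h1) (t2, h2) <= 1 by rewrite sE.
  (* A handover comes with its two heads in either order; symmetry of the crossing lets the larger
     abscissa come first. *)
  have [lt12|lt21|e12] := ltgtP t1 t2; last by rewrite e12 eqxx in t12.
    exists ((t2, h2), (t1, h1)); last by rewrite /fst /snd pairs_sym.
    split=> //; split=> //; rewrite /crossing [pairs _ _]pairs_sym [pairr _ _]pairr_sym.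
    by split.
  by exists ((t1, h1), (t2, h2)).
move=> _ [[[t1 h1] [t2 h2]] /= [w1 [w2 [/= lt12 s01 U0]]] <-].
split=> //; exists t1, h1, t2, h2; split=> //; split=> //; split=> //.
by rewrite gt_eqF.
Qed.

Lemma disk_outside w x y z : w z -> 0 < z.2 -> w `&` Udisk (pairs x y) (pairr x y) = set0 ->
  pairr x y ^+ 2 <= (z.1 - pairs x y) ^+ 2 + z.2 ^+ 2.
Proof.
move=> wz z0 U0; rewrite leNgt; apply/negP => h.
by suff : set0 z by []; rewrite -[set0]U0; split.
Qed.

(** If two crossings share their abscissa, the heads of each pair lie outside the empty disk of the
    other, so each radius is at most the other. All four heads are then on one circle, genericity
    identifies the pairs as sets, and the order by abscissa excludes a swap. *)
Lemma crossing_inj w : w `<=` @Hplus R -> generic w ->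
  set_inj [set p | w p.1 /\ w p.2 /\ crossing w p.1 p.2] (fun p => pairs p.1 p.2).
Proof.
move=> wH gw [x y] [x' y']; rewrite !inE /=.
move=> [wx [wy [yx _ U]]] [wx' [wy' [yx' _ U']]] ss.
have rr : pairr x y ^+ 2 = pairr x' y' ^+ 2.
  apply/eqP; rewrite eq_le; apply/andP; split.
    rewrite (@pairr_l _ x' y') ?gt_eqF// -ss.
    by apply: disk_outside U => //; exact: wH.
  rewrite (@pairr_l _ x y) ?gt_eqF// ss.
  by apply: disk_outside U' => //; exact: wH.
have on z : w z -> (z.1 - pairs x' y') ^+ 2 + z.2 ^+ 2 = pairr x' y' ^+ 2 -> z = x \/ z = y.
  move=> wz zE; have [->|zx] := pselect (z = x); first by left.
  have [->|zy] := pselect (z = y); first by right.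
  by exfalso; apply: (gw x y z) => //; split=> //; rewrite ss zE rr.
have x'E := on x' wx' (esym (@pairr_l _ x' y' (negbT (gt_eqF yx')))).
have y'E := on y' wy' (esym (@pairr_r _ x' y' (negbT (gt_eqF yx')))).
case: x'E => x'E; case: y'E => y'E; subst x' y' => //.
- by rewrite ltxx in yx'.
- by have := lt_trans yx yx'; rewrite ltxx.
- by rewrite ltxx in yx'.
Qed.

Definition crossing_term (f : Cfg R -> \bar R) w x y : \bar R :=
  ((\1_[set p | crossing w p.1 p.2] (x, y))%:E * f (theta (pairs x y) w))%E.

Lemma crossing_term_ge0 f w x y : (forall w, 0 <= f w)%E -> (0 <= crossing_term f w x y)%E.
Proof. by move=> f0; rewrite mule_ge0// lee_fin. Qed.

Lemma handover_sum (f : Cfg R -> \bar R) w : (forall w, 0 <= f w)%E ->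
  w `<=` @Hplus R -> generic w ->
  (\esum_(s in handover w `&` [set s : R | (0 <= s <= 1)%R]) f (theta s w) =
   \esum_(x in w) \esum_(y in w) crossing_term f w x y)%E.
Proof.
move=> f0 wH gw; rewrite handoverE esum_image; last exact: crossing_inj.
rewrite esum_esum; last by move=> *; exact: crossing_term_ge0.
rewrite [LHS]esum_mkcond [RHS]esum_mkcond; apply: eq_esum => -[x y] _ /=.
rewrite /crossing_term /= indicE /=.
have [cw|ncw] := pselect (crossing w x y); last first.
  rewrite [X in _ = if _ then X else _](_ : _ = 0%E).
    rewrite memNset ?if_same// => -[_ []].
    by move=> _ /ncw.
  by rewrite memNset ?mul0e// => /ncw.
rewrite [(x, y) \in [set p | crossing w p.1 p.2]]mem_set// mul1e.
by congr (if _ then _ else _); apply/idP/idP; rewrite !inE => -[wx]; [case|].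
Qed.

(** The two heads are on the boundary circle and the disk is open. *)
Lemma crossing_setU w x y : x.1 != y.1 ->
  ((w `|` [set x]) `|` [set y]) `&` Udisk (pairs x y) (pairr x y) = set0 <->
  w `&` Udisk (pairs x y) (pairr x y) = set0.
Proof.
move=> xy; split=> h; apply/seteqP; split=> // z [] /=.
  by move=> wz Uz; suff : set0 z by []; rewrite -[set0]h; split=> //; left; left.
move=> [[wz|->]|->] Uz.
- by suff : set0 z by []; rewrite -[set0]h.
- by case: Uz => _; rewrite pairr_l// ltxx.
- by case: Uz => _; rewrite pairr_r// ltxx.
Qed.

End HandoverSum.

(** * Genericity of Poisson configurations *)

Section GoodPoints.
Context {R : realType}.
Implicit Types (w : set (R * R)) (x y z : R * R).

Lemma esum_setU1 w x (g : R * R -> \bar R) : (forall y, 0 <= g y)%E -> g x = 0%E ->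
  (\esum_(y in w `|` [set x]) g y = \esum_(y in w) g y)%E.
Proof.
move=> g0 gx; rewrite [LHS]esum_mkcond [RHS]esum_mkcond; apply: eq_esum => y _.
have [wy|nwy] := pselect (w y); first by rewrite !mem_set//; left.
rewrite [in RHS]memNset//; case: ifPn => //; rewrite inE => -[//|->//].
Qed.

Lemma good_setU1 w x : good w -> Hplus x -> good (w `|` [set x]).
Proof.
move=> [wH wD] xH; split=> [y [/wH//|->//]|m].
have fin : finite_set ((w `|` [set x]) `&` annulus m).
  rewrite setIUl; rewrite finite_setU; split; first exact/npts_finite/wD.
  by apply: sub_finite_set (finite_set1 x) => y [].
by rewrite /npts esum_cst1// ltry.
Qed.

(** Removes the diagonal term that the Mecke formula leaves behind, when the integrand vanishes at
    the added point. *)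
Lemma integral_kappa_setU1 w x (g : R * R -> \bar R) :
  good w -> Hplus x -> (forall y, 0 <= g y)%E -> measurable_fun setT g -> g x = 0%E ->
  (\int[kappa (w `|` [set x])]_y g y = \int[kappa w]_y g y)%E.
Proof.
move=> gw xH g0 mg gx; rewrite !integral_kappa// !rho_good//; last exact: good_setU1.
exact: esum_setU1.
Qed.

Lemma measurable_kappa_int d (T : measurableType d) (phi : T -> Cfg R)
    (F : T -> R * R -> \bar R) :
  measurable_fun setT phi -> (forall t x, 0 <= F t x)%E ->
  measurable_fun setT (fun p : T * (R * R) => F p.1 p.2) ->
  measurable_fun setT (fun t => \int[kappa (phi t)]_x F t x)%E.
Proof.
move=> mphi F0 mF.
exact: (measurable_integral_kappa d T phi mphi (fun p => F p.1 p.2) (fun p => F0 p.1 p.2) mF).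
Qed.

Lemma measurable_cocyclic d (T : measurableType d) (f g h : T -> R * R) :
  measurable_fun setT f -> measurable_fun setT g -> measurable_fun setT h ->
  measurable [set t | cocyclic (f t) (g t) (h t)].
Proof.
move=> mf mg mh; have [f1 f2] := measurable_fun_coord mf.
have [g1 g2] := measurable_fun_coord mg; have [h1 h2] := measurable_fun_coord mh.
have mne (a b : T -> R * R) : measurable_fun setT a -> measurable_fun setT b ->
    measurable [set t | a t <> b t].
  move=> /measurable_fun_coord[a1 a2] /measurable_fun_coord[b1 b2].
  rewrite (_ : [set _ | _] =
      ~` ([set t | (a t).1 = (b t).1] `&` [set t | (a t).2 = (b t).2])).
    by apply/measurableC/measurableI; exact: measurable_eqr_set.
  apply/seteqP; split=> t /= nab; first
    by move=> [e1 e2]; apply: nab; rewrite [a t]surjective_pairing e1 e2 -surjective_pairing.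
  by move=> e; apply: nab; rewrite e.
rewrite (_ : [set _ | _] = ([set t | (g t).1 < (f t).1] `&` [set t | h t <> f t]) `&`
  ([set t | h t <> g t] `&`
   [set t | ((h t).1 - pairs (f t) (g t)) ^+ 2 + (h t).2 ^+ 2 = pairr (f t) (g t) ^+ 2])).
  apply: measurableI; apply: measurableI.
  - exact: measurable_ltr_set.
  - exact: mne.
  - exact: mne.
  - apply: measurable_eqr_set; last exact: measurable_sqr_pairr.
    apply: measurable_funD; last exact: measurable_funX.
    by apply: measurable_funX; apply: measurable_funB => //; exact: measurable_pairs.
by apply/seteqP; split=> t /= [] => [? ? ? ?|[? ?] [? ?]].
Qed.

(** Each vertical line meets the circle in at most two points; [r] is the squared radius. *)
Lemma leb_plane_circle (s r : R) :
  leb_plane R [set z | (z.1 - s) ^+ 2 + z.2 ^+ 2 = r] = 0%E.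
Proof.
rewrite /leb_plane /product_measure1; apply: integral0_eq => a _ /=.
pose b := Num.sqrt (r - (a - s) ^+ 2).
set X := xsection _ _.
have XE : X `<=` [set b; - b].
  move=> c; rewrite /X /xsection /= inE /= => E.
  have cE : c ^+ 2 = r - (a - s) ^+ 2 by rewrite -E; ring.
  have : c ^+ 2 == b ^+ 2 by rewrite /b sqr_sqrtr -cE// sqr_ge0.
  by rewrite eqf_sqr => /orP[] /eqP ->; [left|right].
apply: countable_lebesgue_measure0; apply: sub_countable (finite_set_countable (finite_set2 b (- b))).
exact: subset_card_le.
Qed.

End GoodPoints.

Section Genericity.
Context {R : realType} (lam : R) (hlam : 0 < lam).
Context (P : probability (Cfg R) R) (hP : is_poisson_law lam P).
Implicit Types (w : set (R * R)) (x y z : R * R).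

Definition coc_ind x y z : \bar R := (\1_[set p : (R * R) * (R * R) * (R * R) |
  cocyclic p.1.1 p.1.2 p.2] (x, y, z))%:E.

Lemma coc_ind_ge0 x y z : (0 <= coc_ind x y z)%E.
Proof. by rewrite lee_fin. Qed.

Lemma coc_ind0 x y z : ~ cocyclic x y z -> coc_ind x y z = 0%E.
Proof. by move=> n; rewrite /coc_ind indicE memNset. Qed.

Lemma measurable_coc_ind d (T : measurableType d) (f g h : T -> R * R) :
  measurable_fun setT f -> measurable_fun setT g -> measurable_fun setT h ->
  measurable_fun setT (fun t => coc_ind (f t) (g t) (h t)).
Proof.
move=> mf mg mh; have mA : measurable [set p : (R * R) * (R * R) * (R * R) |
    cocyclic p.1.1 p.1.2 p.2].
  by apply: measurable_cocyclic => //; apply: measurableT_comp.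
apply: (measurableT_comp (f := EFin \o \1_[set p : (R * R) * (R * R) * (R * R) |
    cocyclic p.1.1 p.1.2 p.2]) (g := fun t => (f t, g t, h t))).
  by apply/measurable_EFinP/measurable_indic.
by apply: measurable_fun_pair => //; exact: measurable_fun_pair.
Qed.

(** For good [w], [coc0 w] counts the cocyclic triples; the partial sums have names because the
    Mecke formula peels off one head at a time. *)
Definition coc2 w x y := (\int[kappa w]_z coc_ind x y z)%E.
Definition coc1 w x := (\int[kappa w]_y coc2 w x y)%E.
Definition coc0 w := (\int[kappa w]_x coc1 w x)%E.

Lemma measurable_coc2 d (T : measurableType d) (phi : T -> Cfg R) (f g : T -> R * R) :
  measurable_fun setT phi -> measurable_fun setT f -> measurable_fun setT g ->
  measurable_fun setT (fun t => coc2 (phi t) (f t) (g t)).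
Proof.
move=> mphi mf mg; apply: (@measurable_kappa_int _ _ _ phi
  (fun t z => coc_ind (f t) (g t) z)) => // [t z|]; first exact: coc_ind_ge0.
by apply: measurable_coc_ind => //; exact: measurableT_comp.
Qed.

Lemma coc2_ge0 w x y : (0 <= coc2 w x y)%E.
Proof. by apply: integral_ge0 => z _; exact: coc_ind_ge0. Qed.

Lemma measurable_coc1 d (T : measurableType d) (phi : T -> Cfg R) (f : T -> R * R) :
  measurable_fun setT phi -> measurable_fun setT f ->
  measurable_fun setT (fun t => coc1 (phi t) (f t)).
Proof.
move=> mphi mf; apply: (@measurable_kappa_int _ _ _ phi
  (fun t z => coc2 (phi t) (f t) z)) => // [t z|]; first exact: coc2_ge0.
by apply: measurable_coc2 => //; exact: measurableT_comp.
Qed.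

Lemma coc1_ge0 w x : (0 <= coc1 w x)%E.
Proof. by apply: integral_ge0 => z _; exact: coc2_ge0. Qed.

Lemma measurable_coc0 : measurable_fun setT (fun w : Cfg R => coc0 w).
Proof.
apply: (@measurable_kappa_int _ _ (Cfg R) id
  (fun w x => coc1 w x)) => // [w x|]; first exact: coc1_ge0.
exact: measurable_coc1.
Qed.

Lemma coc0_ge0 w : (0 <= coc0 w)%E.
Proof. by apply: integral_ge0 => z _; exact: coc1_ge0. Qed.

(** After three uses of the Mecke formula the last head ranges over a circle fixed by the first two,
    a Lebesgue null set. *)
Lemma integral_coc0 : (\int[P]_w coc0 w = 0)%E.
Proof.
rewrite (mecke lam hlam P hP (fun p => coc1 p.1 p.2)); last 2 first.
- by move=> p; exact: coc1_ge0.
- exact: measurable_coc1.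
rewrite integral0_eq ?mule0// => x xH /=.
(* The added head [x] contributes neither as second nor as third head, by the clauses [y.1 < x.1]
   and [z <> x] of [cocyclic]. *)
transitivity (\int[P]_w \int[kappa w]_y coc2 w x y)%E.
  apply: (integral_good lam hlam P hP).
  - by move=> w; exact: coc1_ge0.
  - by move=> w; exact: coc1_ge0.
  move=> w gw; transitivity (\int[kappa w]_y coc2 (w `|` [set x]) x y)%E.
    apply: (integral_kappa_setU1 gw xH).
    - by move=> y; exact: coc2_ge0.
    - exact: (@measurable_coc2 _ _ (cst (w `|` [set x]) : R * R -> Cfg R) (cst x) id).
    - apply: integral0_eq => z _; apply: coc_ind0 => -[].
      by rewrite ltxx.
  apply: eq_integral => y _; apply: (integral_kappa_setU1 gw xH).
  - by move=> z; exact: coc_ind_ge0.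
  - exact: (@measurable_coc_ind _ _ (cst x) (cst y) id).
  - by apply: coc_ind0 => -[].
rewrite (mecke lam hlam P hP (fun p => coc2 p.1 x p.2)); last 2 first.
- by move=> p; exact: coc2_ge0.
- exact: (@measurable_coc2 _ _ fst (cst x) snd).
rewrite integral0_eq ?mule0// => y yH /=.
transitivity (\int[P]_w \int[kappa w]_z coc_ind x y z)%E.
  apply: (integral_good lam hlam P hP).
  - by move=> w; exact: coc2_ge0.
  - by move=> w; exact: coc2_ge0.
  move=> w gw; apply: (integral_kappa_setU1 gw yH).
  - by move=> z; exact: coc_ind_ge0.
  - exact: (@measurable_coc_ind _ _ (cst x) (cst y) id).
  - by apply: coc_ind0 => -[].
rewrite (mecke lam hlam P hP (fun p => coc_ind x y p.2)); last 2 first.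
- by move=> p; exact: coc_ind_ge0.
- exact: (@measurable_coc_ind _ _ (cst x) (cst y) snd).
rewrite [X in (_ * X)%E](_ : _ = 0%E) ?mule0//.
set r := pairr x y ^+ 2; set s := pairs x y.
rewrite integral_mkcond.
transitivity (\int[leb_plane R]_z cst 0 z)%E; last exact: integral0.
pose C := [set z : R * R | (z.1 - s) ^+ 2 + z.2 ^+ 2 = r].
have mC : measurable C.
  apply: measurable_eqr_set => //; apply: measurable_funD.
    by apply: measurable_funX; apply: measurable_funB.
  by apply: measurable_funX.
apply: (@integral_eq_off_negligible _ _ _ (leb_plane R) (~` C)) => //.
- exact: measurableC.
- by rewrite setCK; exact: leb_plane_circle.
- by apply: erestrict_ge0 => z _; apply: integral_ge0 => *; exact: coc_ind_ge0.
move=> z nCz; rewrite patchE; case: ifPn => // _; apply: integral0_eq => w _.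
by apply: coc_ind0 => -[_ _ _ /nCz].
Qed.

(** A measurable stand-in for [generic], whose quantifiers over points do not exhibit it as an
    event. *)
Definition generic_good : set (Cfg R) := [set w : Cfg R | good w] `&` [set w : Cfg R | coc0 w = 0%E].

Lemma measurable_generic_good : measurable generic_good.
Proof.
apply: measurableI; first exact: measurable_good.
rewrite -[X in measurable X]setTI.
exact: (measurable_coc0 measurableT (emeasurable_set1 0%E)).
Qed.

(** A single cocyclic triple would force [coc0 w] to be at least 1. *)
Lemma generic_good_generic w : generic_good w -> generic w.
Proof.
move=> [gw w0] x y z wx wy wz cxyz.
have le1 (g : R * R -> \bar R) (a : R * R) : (forall y, 0 <= g y)%E -> measurable_fun setT g ->
    w a -> (g a <= \int[kappa w]_x g x)%E.
  move=> g0 mg wa; rewrite integral_kappa// rho_good//; have <- := esum_set1 (g0 a).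
  by apply: esum_subset => _ ->.
have : (1 <= coc0 w)%E; last by rewrite w0 lee_fin ler10.
have -> : 1%E = coc_ind x y z by rewrite /coc_ind indicE mem_set.
apply: (@le_trans _ _ (coc2 w x y)).
  apply: (le1 (coc_ind x y) z _ _ wz); first by move=> ?; exact: coc_ind_ge0.
  exact: (@measurable_coc_ind _ _ (cst x) (cst y) id).
apply: (@le_trans _ _ (coc1 w x)).
  apply: (le1 (coc2 w x) y _ _ wy); first by move=> ?; exact: coc2_ge0.
  exact: (@measurable_coc2 _ _ (cst w : R * R -> Cfg R) (cst x) id).
apply: (le1 (coc1 w) x _ _ wx); first by move=> ?; exact: coc1_ge0.
exact: (@measurable_coc1 _ _ (cst w : R * R -> Cfg R) id).
Qed.

Lemma negligible_not_generic_good : P (~` generic_good) = 0%E.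
Proof.
have [+ _] := ae_eq_integral_abs P measurableT measurable_coc0.
have E : (\int[P]_w `|coc0 w| = 0)%E.
  by rewrite -[RHS]integral_coc0; apply: eq_integral => w _; rewrite gee0_abs// coc0_ge0.
move=> /(_ E) [N [mN N0 hN]].
apply/eqP; rewrite eq_le measure_ge0 andbT.
apply: (@le_trans _ _ (P (~` [set w : Cfg R | good w] `|` N))).
  apply: le_measure; rewrite ?inE.
  - by apply: measurableC; exact: measurable_generic_good.
  - by apply: measurableU => //; apply: measurableC; exact: measurable_good.
  move=> w; rewrite /generic_good setCI => -[nw|nw]; [by left|right].
  by apply: hN => /= /(_ I).
have : (P (~` [set w : Cfg R | good w]) + P N)%E = 0%E.
  by rewrite (negligible_bad _ hlam _ hP) N0 adde0.
move=> /eqP; rewrite eq_le => /andP[h _]; apply: le_trans (measureU2 _ _ _) h => //.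
by apply: measurableC; exact: measurable_good.
Qed.

End Genericity.

(** * The pair formula *)

Lemma eq_indic (R : pzRingType) (T U : Type) (A : set T) (B : set U) x y :
  (A x <-> B y) -> \1_A x = \1_B y :> R.
Proof.
by move=> AB; rewrite !indicE; congr (_%:R); congr nat_of_bool; apply/idP/idP;
  rewrite !inE => /AB.
Qed.

Section IteratedIntegrals.
Context {R : realType}.
Notation leb := (@lebesgue_measure R).

Lemma mule_congr2 (c a b : \bar R) : a = b -> (c * a = c * b)%E.
Proof. by move=> ->. Qed.

Lemma measurable_integral_r d (T : measurableType d) (g : T -> R -> \bar R) :
  measurable_fun setT (fun p : T * R => g p.1 p.2) -> (forall t x, 0 <= g t x)%E ->
  measurable_fun setT (fun t => \int[leb]_x g t x)%E.
Proof.
move=> mg g0.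
exact: (measurable_fun_fubini_tonelli_F (m2 := leb) (fun p => g p.1 p.2) mg (fun p => g0 p.1 p.2)).
Qed.

Lemma integral_swap (g : R -> R -> \bar R) :
  measurable_fun setT (fun p : R * R => g p.1 p.2) -> (forall t x, 0 <= g t x)%E ->
  (\int[leb]_x \int[leb]_y g x y = \int[leb]_y \int[leb]_x g x y)%E.
Proof.
move=> mg g0.
exact: (fubini_tonelli (m1 := leb) (m2 := leb) (fun p => g p.1 p.2) mg (fun p => g0 p.1 p.2)).
Qed.

(* The library puts Lebesgue measure on [measurableTypeR R], whose display differs
   from that of [R]: the two products are identified by pushing along the identity. *)
Lemma integral_plane (g : R * R -> \bar R) :
  measurable_fun setT g -> (forall p, 0 <= g p)%E ->
  (\int[leb_plane R]_p g p = \int[leb]_x \int[leb]_y g (x, y))%E.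
Proof.
move=> mg g0; have mid : measurable_fun setT
    (id : (measurableTypeR R * measurableTypeR R)%type -> (R * R)%type).
  by move=> _ Y mY; rewrite setTI; exact: mY.
pose mu := lebesgue_integral_fubini_product_measure1__canonical__measure_function_Measure leb leb.
transitivity (\int[measure_function_pushforward__canonical__measure_function_Measure
  mu mid]_p g p)%E; first exact: eq_measure_integral.
rewrite (ge0_integral_pushforward mid)//.
exact: (fubini_tonelli1 (m1 := leb) (m2 := leb) g mg g0).
Qed.

(** Measurability through arbitrary measurable coordinates does not depend on how the four variables
    are ordered and bracketed in a product. *)
Definition measurable4 (g : R -> R -> R -> R -> \bar R) := forall d (T : measurableType d)
  (a b c e : T -> R), measurable_fun setT a -> measurable_fun setT b ->
  measurable_fun setT c -> measurable_fun setT e ->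
  measurable_fun setT (fun z => g (a z) (b z) (c z) (e z)).

(** Brings the abscissa [t] of the first head innermost, where only the unit window depends on it,
    and leaves the others in the order of the final formula. *)
Lemma integral_rotate4 (g : R -> R -> R -> R -> \bar R) :
  measurable4 g -> (forall a b c e, 0 <= g a b c e)%E ->
  (\int[leb]_t \int[leb]_h \int[leb]_v \int[leb]_k g t h v k =
   \int[leb]_h \int[leb]_k \int[leb]_v \int[leb]_t g t h v k)%E.
Proof.
move=> mg g0.
have i0 (a b c e : R -> R) : (0 <= \int[leb]_x g (a x) (b x) (c x) (e x))%E.
  by apply: integral_ge0 => x _.
transitivity (\int[leb]_h \int[leb]_t \int[leb]_v \int[leb]_k g t h v k)%E.
  apply: (@integral_swap (fun t h => \int[leb]_v \int[leb]_k g t h v k)%E).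
    apply: (@measurable_integral_r _ _ (fun p v => \int[leb]_k g p.1 p.2 v k)%E).
      apply: (@measurable_integral_r _ _ (fun p k => g p.1.1 p.1.2 p.2 k)) => //.
      exact: (mg _ _ _ _ _ _ (measurableT_comp measurable_fst (measurableT_comp measurable_fst measurable_fst))
        (measurableT_comp measurable_snd (measurableT_comp measurable_fst measurable_fst)) (measurableT_comp measurable_snd measurable_fst) measurable_snd).
    by move=> p v; exact: (i0 (cst p.1) (cst p.2) (cst v) id).
  by move=> t h; apply: integral_ge0 => v _; exact: (i0 (cst t) (cst h) (cst v) id).
apply: eq_integral => h _.
transitivity (\int[leb]_v \int[leb]_t \int[leb]_k g t h v k)%E.
  apply: (@integral_swap (fun t v => \int[leb]_k g t h v k)%E).
    apply: (@measurable_integral_r _ _ (fun p k => g p.1 h p.2 k)) => //.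
    exact: (mg _ _ _ (cst h) _ _ (measurableT_comp measurable_fst measurable_fst) (measurable_cst h) (measurableT_comp measurable_snd measurable_fst) measurable_snd).
  by move=> t v; exact: (i0 (cst t) (cst h) (cst v) id).
transitivity (\int[leb]_v \int[leb]_k \int[leb]_t g t h v k)%E.
  by apply: eq_integral => v _; apply: (@integral_swap (fun t k => g t h v k)) => //; exact: mg.
apply: (@integral_swap (fun v k => \int[leb]_t g t h v k)%E); last by move=> v k; exact: (i0 id (cst h) (cst v) (cst k)).
apply: (@measurable_integral_r _ _ (fun p t => g t h p.1 p.2)) => //.
exact: (mg _ _ snd (cst h) _ _ measurable_snd (measurable_cst h) (measurableT_comp measurable_fst measurable_fst) (measurableT_comp measurable_snd measurable_fst)).
Qed.

(** The window is a translate of the unit interval, of length 1 whatever [c] is. *)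
Lemma integral_unit_window (c : R) (C : \bar R) : (0 <= C)%E ->
  (\int[leb]_t ((\1_[set t : R | 0 <= t + c <= 1] t)%:E * C) = C)%E.
Proof.
move=> C0; pose g (t : R) : \bar R := ((\1_`[0%R, 1%R] t : R)%:E * C)%E.
have g0 t : (0 <= g t)%E by rewrite mule_ge0// lee_fin.
have m1 : measurable_fun setT (fun t : R => (\1_`[0%R, 1%R] t : R)%:E).
  by apply/measurable_EFinP/measurable_indic.
have mg : measurable_fun setT g.
  exact: (emeasurable_funM m1 (measurable_cst C)).
transitivity (\int[leb]_t g (t + c)%R)%E.
  by apply: eq_integral => t _; rewrite /g !indicE !mem_setE /= in_itv.
rewrite integral_translate// /g ge0_integralZr//.
have e : (\int[leb]_t (\1_`[0%R, 1%R] t : R)%:E = 1)%E.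
  rewrite integral_indic// setIT; transitivity (leb `[0%R, 1%R]%classic) => //.
  by rewrite lebesgue_measure_itv /= lte01 oppr0 adde0.
by rewrite -[RHS]mul1e; apply: (congr1 (fun z => z * C)%E).
Qed.

End IteratedIntegrals.

(** * The expected sum over the handovers of a unit window *)

Section Numerator.
Context {R : realType} (lam : R) (hlam : 0 < lam).
Context (P : probability (Cfg R) R) (hP : is_poisson_law lam P).
Context (f : Cfg R -> \bar R) (f0 : forall w, (0 <= f w)%E) (mf : measurable_fun setT f).
Implicit Types (w : set (R * R)) (x y z : R * R).
Notation leb := (@lebesgue_measure R).

Lemma measurable_crossing_term d (T : measurableType d) (phi : T -> Cfg R) (a b : T -> R * R) :
  measurable_fun setT phi -> measurable_fun setT a -> measurable_fun setT b ->
  measurable_fun setT (fun t => crossing_term f (rho (phi t)) (a t) (b t)).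
Proof.
move=> mphi ma mb; apply: emeasurable_funM.
  apply/measurable_EFinP.
  rewrite (_ : (fun _ => _) = \1_[set t | crossing (rho (phi t)) (a t) (b t)]).
    by apply: measurable_indic; exact: measurable_crossing.
  by apply/funext => t; exact: eq_indic.
apply: (measurableT_comp mf); apply: (measurable_theta_rho _ _ phi mphi).
exact: measurable_pairs.
Qed.

(** The integrand of the Palm formula for two arbitrary added heads; emptiness concerns [w]
    alone. *)
Definition void_weight x y w : \bar R :=
  ((\1_[set w : Cfg R | w `&` Udisk (pairs x y) (pairr x y) = set0] w)%:E *
   f (theta (pairs x y) (w `|` [set x] `|` [set y])))%E.

Lemma void_weight_ge0 x y w : (0 <= void_weight x y w)%E.
Proof. by rewrite mule_ge0// lee_fin. Qed.

Lemma measurable_void_weight x y : measurable_fun setT (fun w : Cfg R => void_weight x y w).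
Proof.
apply: emeasurable_funM.
  apply/measurable_EFinP/measurable_indic; apply: measurable_void.
  apply: measurableI; first exact: measurable_ltr_set.
  apply: measurable_ltr_set => //; apply: measurable_funD; last exact: measurable_funX.
  by apply: measurable_funX; apply: measurable_funB.
apply: (measurableT_comp mf); apply: (measurableT_comp (measurable_theta _)).
by apply: (measurableT_comp (measurable_setU1 _)); exact: measurable_setU1.
Qed.

Definition pair_mass x y : \bar R := (\int[P]_w void_weight x y w)%E.

Lemma pair_mass_ge0 x y : (0 <= pair_mass x y)%E.
Proof. by apply: integral_ge0 => w _; exact: void_weight_ge0. Qed.

(** Moving both heads by [t] moves the crossing by [t] and keeps its radius, which amounts to
    shifting the configuration; stationarity removes the shift. *)
Lemma pair_mass_translate (t : R) x y : x.1 != y.1 ->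
  pair_mass (x.1 + t, x.2) (y.1 + t, y.2) = pair_mass x y.
Proof.
move=> xy; rewrite -[RHS](integral_stationary lam hlam P hP t); last 2 first.
- by move=> w; exact: void_weight_ge0.
- exact: measurable_void_weight.
apply: eq_integral => w _; rewrite /void_weight.
have ne : x.1 - y.1 != 0 by rewrite subr_eq0.
have sE : pairs (x.1 + t, x.2) (y.1 + t, y.2) = pairs x y + t.
  rewrite /pairs /shat /=; by field; rewrite ne.
have rE : pairr (x.1 + t, x.2) (y.1 + t, y.2) = pairr x y.
  by rewrite /pairr /hhat /hhat2 /= (_ : x.1 + t - (y.1 + t) = x.1 - y.1)//; ring.
rewrite sE rE; congr (_ * f _)%E.
  have UE : Udisk (pairs x y + t) (pairr x y) =
      [set p | Udisk (pairs x y) (pairr x y) (p.1 - t, p.2)].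
    by apply/seteqP; split=> p; rewrite /Udisk /= opprD addrA addrAC.
  by congr (_%:E); apply: eq_indic; rewrite /= UE; split=> h; apply/theta_void.
by rewrite -theta_theta !theta_setU1 /= !addrK.
Qed.

Lemma numerator_mecke :
  (\int[P]_w (\esum_(s in handover w `&` [set s : R | (0 <= s <= 1)%R]) f (theta s w)) =
   (2 * lam)%:E * \int[leb_plane R]_(x in @Hplus R) ((2 * lam)%:E *
     \int[leb_plane R]_(y in @Hplus R)
       \int[P]_w crossing_term f (rho (w `|` [set y] `|` [set x])) x y))%E.
Proof.
have mU x : measurable_fun setT (fun p : Cfg R * (R * R) => (p.1 `|` [set x] : Cfg R)).
  exact: (measurableT_comp (measurable_setU1 x) measurable_fst).
have ct0 w x y : (0 <= crossing_term f w x y)%E by exact: crossing_term_ge0.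
(* The Mecke formula takes a measurable functional, so the sum over handovers is first replaced by a
   double kernel integral that equals it almost surely. *)
transitivity (\int[P]_w \int[kappa w]_x \int[kappa w]_y crossing_term f (rho w) x y)%E.
  apply: (integral_eq_off_negligible _ _ _ P (generic_good (R:=R))).
  - exact: measurable_generic_good.
  - by have := negligible_not_generic_good hlam hP.
  - by move=> w; apply: esum_ge0.
  - by move=> w; do 2 apply: integral_ge0 => ? _.
  move=> w gw; have gd : good w by case: gw.
  rewrite handover_sum//; [|by case: gd|exact: generic_good_generic].
  rewrite integral_kappa; last 2 first.
  - by move=> x; apply: integral_ge0 => ? _.
  - apply: (@measurable_kappa_int _ _ _ (cst w : R * R -> Cfg R) (fun x y => crossing_term f (rho w) x y)) => //.
    exact: (@measurable_crossing_term _ _ (cst w : (R * R) * (R * R) -> Cfg R) fst snd).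
  rewrite rho_good//; apply: eq_esum => x _; rewrite integral_kappa//; last first.
    by have := @measurable_crossing_term _ _ (cst w : R * R -> Cfg R) (cst x) id; rewrite /= rho_good//; apply.
  by rewrite rho_good.
rewrite (mecke lam hlam P hP
  (fun p => \int[kappa p.1]_y crossing_term f (rho p.1) p.2 y)%E); last 2 first.
- by move=> p; apply: integral_ge0 => ? _.
- apply: (@measurable_kappa_int _ _ _ fst (fun p y => crossing_term f (rho p.1) p.2 y)) => //.
  apply: (@measurable_crossing_term _ _ (fun p => p.1.1) (fun p => p.1.2) snd) => //.
    exact: (measurableT_comp measurable_fst measurable_fst).
  exact: (measurableT_comp measurable_snd measurable_fst).
congr (_ * _)%E; apply: eq_integral => x; rewrite inE => xH.
(* The head [x] is not paired with itself, as [crossing] asks for a strict inequality of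
   abscissae. *)
transitivity (\int[P]_w \int[kappa w]_y crossing_term f (rho (w `|` [set x])) x y)%E.
  apply: (integral_good lam hlam P hP).
  - by move=> w; apply: integral_ge0 => ? _.
  - by move=> w; apply: integral_ge0 => ? _.
  move=> w gw; apply: (integral_kappa_setU1 gw xH) => //.
    exact: (@measurable_crossing_term _ _ (cst (w `|` [set x]) : R * R -> Cfg R) (cst x) id).
  rewrite /crossing_term indicE memNset ?mul0e// => -[].
  by rewrite ltxx.
rewrite (mecke lam hlam P hP (fun p => crossing_term f (rho (p.1 `|` [set x])) x p.2))//.
exact: (@measurable_crossing_term _ _ _ (cst x) snd (mU x)).
Qed.

(** The ordering and the window constrain the two heads only and leave the expectation; the heads,
    being on the boundary circle, do not affect emptiness. *)
Lemma pair_mass_crossing x y : Hplus x -> Hplus y ->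
  (\int[P]_w crossing_term f (rho (w `|` [set y] `|` [set x])) x y =
   (\1_[set p | p.2.1 < p.1.1 /\ 0 <= pairs p.1 p.2 <= 1] (x, y))%:E * pair_mass x y)%E.
Proof.
move=> xH yH; rewrite indicE.
have [[yx s01]|n] := pselect (y.1 < x.1 /\ 0 <= pairs x y <= 1); last first.
  rewrite memNset// mul0e; apply: integral0_eq => w _.
  by rewrite /crossing_term indicE memNset ?mul0e// => -[h1 h2 _]; exact: n.
rewrite mem_set// mul1e; apply: (integral_good lam hlam P hP).
- by move=> w; exact: crossing_term_ge0.
- by move=> w; exact: void_weight_ge0.
move=> w gw; rewrite rho_good; last by apply: good_setU1 => //; exact: good_setU1.
rewrite /crossing_term /void_weight setUAC; congr (_ * _)%E.
congr (_%:E); apply: eq_indic; split.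
  by move=> [_ _ /crossing_setU]; apply; rewrite gt_eqF.
by move=> h; split=> //; apply/crossing_setU => //; rewrite gt_eqF.
Qed.

(** Half-plane constraints are written as indicators so that all coordinates range over the line,
    where Tonelli and translations apply freely. *)
Definition crossing_density x y : \bar R :=
  ((\1_(@Hplus R) x)%:E * ((\1_(@Hplus R) y)%:E *
    \int[P]_w crossing_term f (rho (w `|` [set y] `|` [set x])) x y))%E.

Lemma crossing_density_ge0 x y : (0 <= crossing_density x y)%E.
Proof.
rewrite !mule_ge0 ?lee_fin//; apply: integral_ge0 => w _; exact: crossing_term_ge0.
Qed.

Lemma measurable_crossing_density d (T : measurableType d) (a b : T -> R * R) :
  measurable_fun setT a -> measurable_fun setT b ->
  measurable_fun setT (fun z : T => crossing_density (a z) (b z)).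
Proof.
move=> ma mb.
have mI : measurable_fun setT (fun x : R * R => (\1_(@Hplus R) x : R)%:E).
  by apply/measurable_EFinP/measurable_indic; exact: measurable_Hplus.
apply: emeasurable_funM; first exact: (measurableT_comp mI ma).
apply: emeasurable_funM; first exact: (measurableT_comp mI mb).
pose phi := fun p : T * Cfg R => (p.2 `|` [set b p.1] `|` [set a p.1] : Cfg R).
have mphi : measurable_fun setT phi.
  have m1 : measurable_fun setT (fun p : T * Cfg R => (p.2 `|` [set b p.1] : Cfg R)).
    apply: (measurableT_comp (@measurable_add_point R) (g := fun p : T * Cfg R => (p.2, b p.1))).
    apply: measurable_fun_pair; first exact: measurable_snd.
    exact: (measurableT_comp mb measurable_fst).
  apply: (measurableT_comp (@measurable_add_point R)
    (g := fun p : T * Cfg R => ((p.2 `|` [set b p.1] : Cfg R), a p.1))).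
  apply: measurable_fun_pair => //; exact: (measurableT_comp ma measurable_fst).
apply: (measurable_fun_fubini_tonelli_F (m2 := P)
  (fun p => crossing_term f (rho (phi p)) (a p.1) (b p.1))).
  apply: measurable_crossing_term => //.
    exact: (measurableT_comp ma measurable_fst).
  exact: (measurableT_comp mb measurable_fst).
by move=> p; exact: crossing_term_ge0.
Qed.

(** The second head is placed relative to the first, at abscissa [t - v]: the ordering becomes
    [0 < v], and translation invariance can act on [t]. *)
Lemma numerator_density :
  (\int[P]_w (\esum_(s in handover w `&` [set s : R | (0 <= s <= 1)%R]) f (theta s w)) =
   ((2 * lam) ^+ 2)%:E * \int[leb]_t \int[leb]_h \int[leb]_v \int[leb]_k
      crossing_density (t, h) ((t - v)%R, k))%E.
Proof.
have l0 : (0 <= (2 * lam)%:E)%E by rewrite lee_fin mulr_ge0// ltW.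
rewrite numerator_mecke.
have -> : ((2 * lam) ^+ 2)%:E = ((2 * lam)%:E * (2 * lam)%:E)%E by rewrite -EFinM -expr2.
rewrite -muleA; congr (_ * _)%E.
transitivity (\int[leb_plane R]_x ((2 * lam)%:E * \int[leb_plane R]_y crossing_density x y))%E.
  rewrite integral_mkcond; apply: eq_integral => x _; rewrite patchE /crossing_density.
  rewrite [(\1_(@Hplus R) x)]indicE; case: ifPn => xH; last first.
    by rewrite integral0_eq ?mule0// => y _; rewrite mul0e.
  congr (_ * _)%E; rewrite integral_mkcond; apply: eq_integral => y _; rewrite patchE mul1e.
  by rewrite indicE; case: ifPn => yH; rewrite ?mul1e ?mul0e.
have mpl : measurable_fun setT (fun x => \int[leb_plane R]_y crossing_density x y)%E.
  apply: (measurable_fun_fubini_tonelli_F (m2 := leb_plane R)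
    (fun p => crossing_density p.1 p.2)).
    by apply: measurable_crossing_density.
  by move=> p; exact: crossing_density_ge0.
have ge0 x : (0 <= \int[leb_plane R]_y crossing_density x y)%E.
  by apply: integral_ge0 => y _; exact: crossing_density_ge0.
transitivity ((2 * lam)%:E * \int[leb_plane R]_x \int[leb_plane R]_y crossing_density x y)%E.
  by apply: ge0_integralZl.
apply: mule_congr2.
rewrite (integral_plane mpl ge0).
apply: eq_integral => t _; apply: eq_integral => h _.
have mth d (T : measurableType d) (u : T -> R * R) : measurable_fun setT u ->
    measurable_fun setT (fun z : T => crossing_density (t, h) (u z)).
  by move=> mu; exact: measurable_crossing_density.
have cd0 y : (0 <= crossing_density (t, h) y)%E by exact: crossing_density_ge0.
rewrite (integral_plane (mth _ _ id (@measurable_id _ _ _)) cd0).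
pose G (u : R) := (\int[leb]_k crossing_density (t, h) (u, k))%E.
have G0 u : (0 <= G u)%E by apply: integral_ge0 => k _; exact: crossing_density_ge0.
have mG : measurable_fun setT G.
  apply: (@measurable_integral_r _ _ _ (fun u k => crossing_density (t, h) (u, k))).
    by apply: mth; exact: measurable_fun_pair.
  by move=> *; exact: crossing_density_ge0.
have mGt : measurable_fun setT (fun u : R => G (u + t)).
  by apply: (measurableT_comp mG); apply: measurable_funD.
transitivity (\int[leb]_u G (u + t)%R)%E; first exact: esym (integral_translate _ _ G0 mG).
apply: etrans (esym (integral_reflect (fun u => G (u + t)) (fun u => G0 (u + t)) mGt)) _.
by apply: eq_integral => v _; rewrite /G addrC.
Qed.

Lemma crossing_densityE t h v k : crossing_density (t, h) (t - v, k) =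
  ((\1_[set t : R | 0 <= t + pairs (0, h) (- v, k) <= 1] t)%:E *
   ((\1_[set x : R | (0 < x)%R] h)%:E * ((\1_[set x : R | (0 < x)%R] k)%:E *
    ((\1_[set x : R | (0 < x)%R] v)%:E * pair_mass (0%R, h) ((- v)%R, k)))))%E.
Proof.
rewrite /crossing_density.
rewrite [\1_(@Hplus R) _]indicE [\1_[set x | 0 < x] h]indicE.
rewrite (_ : ((t, h) \in @Hplus R) = (h \in [set x : R | 0 < x])); last by apply/idP/idP; rewrite !inE.
have [hH|_] := boolP (h \in [set x : R | 0 < x]); last by rewrite !mul0e mule0.
rewrite !mul1e [\1_(@Hplus R) _]indicE [\1_[set x | 0 < x] k]indicE.
rewrite (_ : ((t - v, k) \in @Hplus R) = (k \in [set x : R | 0 < x])); last by apply/idP/idP; rewrite !inE.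
have [kH|_] := boolP (k \in [set x : R | 0 < x]); last by rewrite !mul0e mule0.
rewrite !mul1e; rewrite !inE /= in hH kH.
rewrite pair_mass_crossing// !indicE.
(* For [v <= 0] both sides vanish; the translation formula, which needs distinct abscissae, is used
   for [0 < v]. *)
have [v0|v0] := ltP 0 v; last first.
  rewrite [v \in _]memNset ?mul0e ?mule0; last by rewrite /= ltNge v0.
  by rewrite memNset ?mul0e//= => -[]; rewrite ltrBlDr ltrDl ltNge v0.
rewrite [v \in _]mem_set// mul1e.
have v1 : (0:R, h).1 != (- v, k).1 by rewrite /= eq_sym oppr_eq0 gt_eqF.
have := pair_mass_translate t v1; rewrite /= add0r (addrC (- v)) => ->.
congr (_ * _)%E; rewrite -!indicE.
have sE : pairs (t, h) (t - v, k) = t + pairs (0, h) (- v, k).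
  by rewrite /pairs /shat /=; field; rewrite gt_eqF//=; rewrite (_ : t - (t - v) = v) ?gt_eqF//; ring.
congr (_%:E); apply: eq_indic; rewrite /= sE; split=> [[]//|->].
by split=> //; rewrite ltrBlDr ltrDl v0.
Qed.

(** Integrating over [0 < v] counts each unordered pair once, which stands for the factor 1/2 of a
    sum over both orders. *)
Theorem numerator_formula :
  (\int[P]_w (\esum_(s in handover w `&` [set s : R | (0 <= s <= 1)%R]) f (theta s w)) =
   ((2 * lam) ^+ 2)%:E * \int[leb]_(h in [set x : R | (0 < x)%R])
      \int[leb]_(k in [set x : R | (0 < x)%R]) \int[leb]_(v in [set x : R | (0 < x)%R])
      pair_mass (0%R, h) ((- v)%R, k))%E.
Proof.
rewrite numerator_density; apply: mule_congr2.
rewrite (@integral_rotate4 _ (fun t h v k => crossing_density (t, h) ((t - v)%R, k))); last 2 first.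
- move=> d T a b c e ma mb mc me; apply: measurable_crossing_density.
    exact: measurable_fun_pair.
  by apply: measurable_fun_pair => //; exact: measurable_funB.
- by move=> *; exact: crossing_density_ge0.
have E h k v : (\int[leb]_t crossing_density (t, h) ((t - v)%R, k) =
   ((\1_[set x : R | (0 < x)%R] h)%:E * ((\1_[set x : R | (0 < x)%R] k)%:E *
    ((\1_[set x : R | (0 < x)%R] v)%:E * pair_mass (0%R, h) ((- v)%R, k)))))%E.
  under eq_integral do rewrite crossing_densityE.
  by rewrite integral_unit_window// !mule_ge0// ?lee_fin// pair_mass_ge0.
rewrite [RHS]integral_mkcond; apply: eq_integral => h _.
rewrite patchE; case: ifPn => hH; last first.
  rewrite integral0_eq// => k _; rewrite integral0_eq// => v _.
  by rewrite E indicE (negbTE hH) mul0e.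
rewrite [RHS]integral_mkcond; apply: eq_integral => k _.
rewrite patchE; case: ifPn => kH; last first.
  rewrite integral0_eq// => v _.
  by rewrite E [\1__ k]indicE (negbTE kH) mul0e mule0.
rewrite [RHS]integral_mkcond; apply: eq_integral => v _.
rewrite E !indicE hH kH !mul1e patchE.
by case: ifPn => vH; rewrite ?mul1e ?mul0e.
Qed.

End Numerator.

(** * Explicit integrals *)

Section Calculus.
Context {R : realType}.
Notation leb := (@lebesgue_measure R).

Lemma is_derive_continuous (F f : R -> R) :
  (forall x : R, is_derive x 1 F (f x)) -> continuous F.
Proof.
move=> dF x; apply: differentiable_continuous; apply/derivable1_diffP.
by case: (dF x).
Qed.

Lemma is_derive_LRcontinuous (F f : R -> R) (a b : R) :
  (forall x : R, is_derive x 1 F (f x)) -> derivable_oo_LRcontinuous F a b.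
Proof.
move=> dF; have cF := is_derive_continuous dF; split.
- by move=> x _; case: (dF x).
- exact/cvg_at_right_filter/cF.
- exact/cvg_at_left_filter/cF.
Qed.

Lemma is_derive_derive1 (F f : R -> R) :
  (forall x : R, is_derive x 1 F (f x)) -> F^`()%classic = f.
Proof. by move=> dF; apply/funext => x; rewrite derive1E derive_val. Qed.

Lemma continuous_half_circle : continuous (fun u : R => Num.sqrt (1 - u ^+ 2)).
Proof.
move=> u; apply: continuous_comp; last exact: sqrt_continuous.
by apply: cvgB; [exact: cvg_cst|exact: exprn_continuous].
Qed.

(** The substitution [u = sin x] leads to the square of the cosine, with antiderivative
    [(x + sin x * cos x) / 2]. *)
Lemma integral_unit_half_circle :
  (\int[leb]_(u in `[(- 1)%R, 1%R]) (Num.sqrt (1 - u ^+ 2))%:E = (pi / 2)%:E)%E.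
Proof.
have pi20 : 0 < (pi : R) / 2 by rewrite divr_gt0// pi_gt0.
have npi : - (pi / 2) < (pi : R) / 2 by lra.
have ds (x : R) : is_derive x 1 (@sin R) (cos x) by exact: is_derive_sin.
have sinE := is_derive_derive1 ds.
have ccos : continuous (@cos R) by exact: continuous_cos.
have h := @integration_by_substitution_increasing R sin
  (fun u => Num.sqrt (1 - u ^+ 2)) (- (pi / 2)) (pi / 2).
rewrite sinN sin_pihalf sinE in h; rewrite h; first last.
- by apply: continuous_subspaceT; exact: continuous_half_circle.
- exact: is_derive_LRcontinuous ds.
- by apply/cvg_ex; exists (cos (pi / 2)); exact/cvg_at_left_filter/ccos.
- by apply/cvg_ex; exists (cos (- (pi / 2))); exact/cvg_at_right_filter/ccos.
- by move=> x _; exact: ccos.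
- by move=> x y xI yI xy; rewrite ltr_sin.
- exact: ltW.
transitivity (\int[leb]_(x in `[(- (pi / 2))%R, (pi / 2)%R]) (cos x ^+ 2)%:E)%E.
  apply: eq_integral => x; rewrite inE/= in_itv/= => xI; congr (_%:E).
  have c0 := cos_ge0_pihalf xI; rewrite /= -[RHS]/(cos x * cos x); congr (_ * _).
  rewrite /= (_ : 1 - sin x ^+ 2 = cos x ^+ 2); first by rewrite sqrtr_sqr ger0_norm.
  by rewrite -(cos2Dsin2 x) addrK.
pose F : R -> R := 2^-1 \*: ((@id R) + sin * cos).
have dF (x : R) : is_derive x 1 F (cos x ^+ 2).
  have dc : is_derive x 1 (@cos R) (- sin x) by exact: is_derive_cos.
  rewrite (_ : cos x ^+ 2 = 2^-1 *: (1 + (sin x *: - sin x + cos x *: cos x))).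
    exact: is_deriveZ.
  have e : cos x * cos x = 1 - sin x * sin x by rewrite -!expr2; have := cos2Dsin2 x; lra.
  by rewrite /GRing.scale /= expr2 mulrN; lra.
rewrite (@continuous_FTC2 R (fun x => cos x ^+ 2) F)//.
- rewrite -EFinB; congr (_%:E).
  have FE u : F u = 2^-1 * (u + sin u * cos u) by [].
  by rewrite !FE sinN cosN sin_pihalf cos_pihalf; lra.
- by apply: continuous_subspaceT => x; exact: (cvgM (ccos x) (ccos x)).
- exact: is_derive_LRcontinuous dF.
- by move=> x _; rewrite (is_derive_derive1 dF).
Qed.

Lemma measurable_sqrt_sub (r : R) : measurable_fun setT (fun x : R => (Num.sqrt (r - x ^+ 2))%:E).
Proof.
apply/measurable_EFinP; apply: (measurableT_comp (f := @Num.sqrt R)).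
  by apply: continuous_measurable_fun; exact: sqrt_continuous.
by apply: measurable_funB => //; exact: measurable_funX.
Qed.

(** [Num.sqrt] is 0 on negative numbers, so the line may replace the interval [x ^+ 2 <= r]; scaling
    by [Num.sqrt r] reduces to radius 1. *)
Lemma integral_half_circle (r : R) : 0 < r ->
  (\int[leb]_x (Num.sqrt (r - x ^+ 2))%:E = (r * (pi / 2))%:E)%E.
Proof.
move=> r0; have sr0 : 0 < Num.sqrt r by rewrite sqrtr_gt0.
have g0 (x : R) : (0 <= (Num.sqrt (r - x ^+ 2))%:E)%E by rewrite lee_fin sqrtr_ge0.
have h := integral_affine (Num.sqrt r) 0 _ sr0 g0 (measurable_sqrt_sub r).
have e : (\int[leb]_x (Num.sqrt (1 - x ^+ 2))%:E = (pi / 2)%:E)%E.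
  rewrite -integral_unit_half_circle [RHS]integral_mkcond; apply: eq_integral => x _.
  rewrite patchE; case: ifPn => //; rewrite notin_setE /= in_itv/= => n.
  rewrite ler0_sqrtr// subr_le0 leNgt; apply/negP => x1; apply: n.
  by apply/andP; split; nra.
have h2 : (\int[leb]_x (Num.sqrt (r - (Num.sqrt r * x + 0) ^+ 2))%:E =
    (Num.sqrt r * (pi / 2))%:E)%E.
  transitivity (\int[leb]_x ((Num.sqrt r)%:E * (Num.sqrt (1 - x ^+ 2))%:E))%E.
    apply: eq_integral => x _; rewrite -EFinM; congr (_%:E).
    rewrite -sqrtrM ?ltW// addr0 exprMn sqr_sqrtr ?ltW//; congr Num.sqrt; ring.
  rewrite EFinM -e; apply: ge0_integralZl => //.
  exact: measurable_sqrt_sub.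
rewrite h in h2.
have := congr1 (fun z => ((Num.sqrt r)%:E * z)%E) h2.
rewrite muleA -EFinM divff ?gt_eqF// mul1e => ->.
have ss : Num.sqrt r * Num.sqrt r = r by rewrite -expr2 sqr_sqrtr// ltW.
by rewrite -EFinM; congr (_%:E); rewrite [LHS]mulrA ss.
Qed.

Lemma leb2_Udisk (s r : R) : 0 < r ^+ 2 ->
  leb2 (Udisk s r) = (r ^+ 2 * (pi / 2))%:E.
Proof.
move=> r0; rewrite /leb2 /product_measure1 -(integral_half_circle r0).
rewrite -(integral_translate (- s) (fun x => (Num.sqrt (r ^+ 2 - x ^+ 2))%:E)); last 2 first.
- by move=> x; rewrite lee_fin sqrtr_ge0.
- exact: measurable_sqrt_sub.
apply: eq_integral => x _ /=.
set q := Num.sqrt _; have q0 : 0 <= q by exact: sqrtr_ge0.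
have -> : xsection (Udisk s r) x = `]0, q[%classic.
  apply/seteqP; split=> y; rewrite /xsection /= inE /Udisk /= in_itv /=.
    move=> [y0 h]; rewrite y0 /q -[y]ger0_norm ?ltW// -sqrtr_sqr ltr_sqrt//.
      by rewrite ltrBrDl.
    by rewrite subr_gt0 (le_lt_trans _ h)// lerDl sqr_ge0.
  move=> /andP[y0 yq]; split=> //; rewrite -ltrBrDl.
  have q1 : 0 < r ^+ 2 - (x - s) ^+ 2.
    by rewrite -sqrtr_gt0 (lt_trans y0).
  by rewrite -(sqr_sqrtr (ltW q1)) ltr_sqr ?nnegrE// ltW.
rewrite lebesgue_measure_itv /= lte_fin; case: ltP => [_|h]; first by rewrite oppr0 adde0.
by rewrite (@le_anti _ _ q 0)// q0 h.
Qed.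

Lemma integral_even (g : R -> \bar R) : (forall x, 0 <= g x)%E -> measurable_fun setT g ->
  (forall x, g (- x) = g x) ->
  (\int[leb]_x g x = 2%:E * \int[leb]_(x in [set x : R | (0 < x)%R]) g x)%E.
Proof.
move=> g0 mg ge; pose p := [set x : R | 0 < x].
have mp : measurable p by exact: measurable_ltr_set.
have mi (A : set R) : measurable A -> measurable_fun setT (g \_ A).
  by move=> mA; apply/(measurable_restrictT _ mA)/measurable_funTS.
have gi (A : set R) x : (0 <= (g \_ A) x)%E by exact: erestrict_ge0.
transitivity (\int[leb]_x ((g \_ p) x + (g \_ p) (- x)%R))%E.
  apply: (integral_eq_off_negligible _ _ _ leb (~` [set 0 : R])) => //.
  - exact: measurableC.
  - by rewrite setCK; exact: lebesgue_measure_set1.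
  - by move=> x; rewrite adde_ge0.
  move=> x /eqP x0; rewrite !patchE ge.
  have [xp|xn|xe] := ltgtP 0 x; last by rewrite -xe eqxx in x0.
    rewrite [x \in p]mem_set// [- x \in p]memNset ?adde0//.
    by rewrite /p /= oppr_gt0; apply/negP; rewrite -leNgt ltW.
  rewrite [x \in p]memNset; last by rewrite /p /=; apply/negP; rewrite -leNgt ltW.
  by rewrite [- x \in p]mem_set ?add0e// /p /= oppr_gt0.
rewrite ge0_integralD//; last 2 first.
- exact: mi.
- by apply: (measurableT_comp (mi _ mp)); exact: oppr_measurable.
rewrite integral_reflect//; last exact: mi.
by rewrite -integral_mkcond -mule2n mule_natl.
Qed.

Lemma integral_scaled_gauss (b : R) : 0 < b ->
  (\int[leb]_x (expR (- (b * x ^+ 2)))%:E = (Num.sqrt pi / Num.sqrt b)%:E)%E.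
Proof.
move=> b0; have sb0 : 0 < Num.sqrt b by rewrite sqrtr_gt0.
have mg : measurable_fun setT (fun x : R => (gauss_fun x)%:E).
  by apply/measurable_EFinP; exact: measurable_gauss_fun.
have g0 (x : R) : (0 <= (gauss_fun x)%:E)%E by rewrite lee_fin gauss_fun_ge0.
have := integral_affine (Num.sqrt b) 0 _ sb0 g0 mg.
rewrite integralT_gauss -EFinM mulrC => <-; apply: eq_integral => x _.
by rewrite /gauss_fun addr0 exprMn sqr_sqrtr// ltW.
Qed.

Lemma integral_first_moment :
  (\int[leb]_(x in `[0%R, +oo[) (x * expR (- x ^+ 2))%:E = (2^-1)%:E)%E.
Proof.
pose F : R -> R := (- 2^-1) \*: (expR \o (fun x => - x ^+ 2)).
have dF (x : R) : is_derive x 1 F (x * expR (- x ^+ 2)).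
  have d1 : is_derive x 1 (fun x : R => - x ^+ 2) (- (2 * x)).
    have := is_deriveN (is_deriveX 2 (is_derive_id x 1)).
    by rewrite /= expr1 [_%:A]mulr1; apply.
  have d2 := is_derive1_comp (g := fun x : R => - x ^+ 2) (is_derive_expR (- x ^+ 2)) d1.
  rewrite (_ : x * _ = (- 2^-1) *: (expR (- x ^+ 2) * - (2 * x))).
    exact: is_deriveZ.
  by rewrite /GRing.scale /=; field.
have cf : continuous (fun x : R => x * expR (- x ^+ 2)).
  by move=> x; apply: cvgM; [exact: cvg_id|exact: continuous_gauss_fun].
rewrite (@ge0_continuous_FTC2y R (fun x => x * expR (- x ^+ 2)) F 0 0).
- rewrite -[F 0]/(- 2^-1 * expR (- 0 ^+ 2)) expr0n /= oppr0 expR0 mulr1.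
  by rewrite -EFinB sub0r opprK.
- by move=> x x0; rewrite mulr_ge0// expR_ge0.
- by apply: continuous_subspaceT.
- rewrite -[X in _ --> X](scaler0 _ (- 2^-1 : R)).
  by apply: cvgZl_tmp; exact: cvg_gauss_fun.
- by move=> x _; case: (dF x).
- exact/cvg_at_right_filter/(is_derive_continuous dF).
- by move=> x _; rewrite (is_derive_derive1 dF).
Qed.

Lemma measurable_abs_gauss (b : R) :
  measurable_fun setT (fun x : R => (`|x| * expR (- (b * x ^+ 2)))%:E).
Proof.
apply/measurable_EFinP/measurable_funM; first exact: normr_measurable.
apply: (measurableT_comp (f := @expR R)); first exact: measurable_expR.
apply: measurable_funN.
by apply: measurable_funM => //; exact: measurable_funX.
Qed.

Lemma integral_abs_gauss (b : R) : 0 < b ->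
  (\int[leb]_x (`|x| * expR (- (b * x ^+ 2)))%:E = (b^-1)%:E)%E.
Proof.
move=> b0; have sb0 : 0 < Num.sqrt b by rewrite sqrtr_gt0.
have ge0 (c x : R) : (0 <= (`|x| * expR (- (c * x ^+ 2)))%:E)%E.
  by rewrite lee_fin mulr_ge0// expR_ge0.
have e : (\int[leb]_x (`|x| * expR (- (1 * x ^+ 2)))%:E = 1)%E.
  rewrite integral_even//; last 2 first.
  - exact: measurable_abs_gauss.
  - by move=> x; rewrite normrN sqrrN.
  rewrite (_ : [set x : R | 0 < x] = `]0, +oo[%classic); last first.
    by apply/seteqP; split=> x; rewrite /= in_itv/= andbT.
  rewrite integral_itv_obnd_cbnd; last by apply: measurable_funTS; exact: measurable_abs_gauss.
  transitivity (2%:E * \int[leb]_(x in `[0%R, +oo[) (x * expR (- x ^+ 2))%:E)%E.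
    apply: mule_congr2; apply: eq_integral => x.
    by rewrite inE/= in_itv/= andbT => x0; rewrite ger0_norm// mul1r.
  by rewrite integral_first_moment -EFinM divff.
have h := integral_affine (Num.sqrt b) 0 _ sb0 (ge0 1) (measurable_abs_gauss 1).
rewrite e mule1 in h.
transitivity (((Num.sqrt b)^-1)%:E * \int[leb]_x
  (`|Num.sqrt b * x + 0| * expR (- (1 * (Num.sqrt b * x + 0) ^+ 2)))%:E)%E; last first.
  by rewrite h -EFinM -invfM -expr2 sqr_sqrtr// ltW.
rewrite -ge0_integralZl//.
- apply: eq_integral => x _; rewrite -EFinM; congr (_%:E).
  rewrite addr0 mul1r exprMn sqr_sqrtr ?(ltW b0)// normrM (gtr0_norm sb0) !mulrA.
  by rewrite mulVf ?mul1r// gt_eqF.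
- exact: (measurableT_comp (measurable_abs_gauss 1) (measurable_affine _ _)).
Qed.

Lemma oneD_sqr_gt0 (u : R) : 0 < 1 + u ^+ 2.
Proof. by rewrite ltr_pwDl// sqr_ge0. Qed.

(** The function (1 + u^2)^(-3/2), whose antiderivative is [u / Num.sqrt (1 + u ^+ 2)]. *)
Definition cauchy32 (u : R) : R := ((1 + u ^+ 2) * Num.sqrt (1 + u ^+ 2))^-1.

Lemma cauchy32_gt0 u : 0 < cauchy32 u.
Proof. by rewrite invr_gt0 mulr_gt0 ?sqrtr_gt0 ?oneD_sqr_gt0. Qed.

Lemma continuous_oneD_sqr : continuous (fun u : R => 1 + u ^+ 2).
Proof. by move=> u; apply: cvgD; [exact: cvg_cst|exact: exprn_continuous]. Qed.

Lemma continuous_cauchy32 : continuous cauchy32.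
Proof.
move=> u; apply: cvgV.
  by rewrite gt_eqF// mulr_gt0 ?sqrtr_gt0 ?oneD_sqr_gt0.
apply: cvgM; first exact: continuous_oneD_sqr.
by apply: continuous_comp; [exact: continuous_oneD_sqr|exact: sqrt_continuous].
Qed.

Lemma measurable_cauchy32 : measurable_fun setT cauchy32.
Proof. by apply: continuous_measurable_fun; exact: continuous_cauchy32. Qed.

Lemma integral_cauchy32 : (\int[leb]_u (cauchy32 u)%:E = 2%:E)%E.
Proof.
have mc : measurable_fun setT (fun u : R => (cauchy32 u)%:E).
  by apply/measurable_EFinP; exact: measurable_cauchy32.
rewrite integral_even//; last 2 first.
- by move=> x; rewrite lee_fin ltW// cauchy32_gt0.
- by move=> x; rewrite /cauchy32 sqrrN.
rewrite (_ : [set x : R | 0 < x] = `]0, +oo[%classic); last first.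
  by apply/seteqP; split=> x; rewrite /= in_itv/= andbT.
rewrite integral_itv_obnd_cbnd; last exact: measurable_funTS.
pose q (u : R) : R := Num.sqrt (1 + u ^+ 2).
have q0 u : 0 < q u by rewrite sqrtr_gt0 oneD_sqr_gt0.
have qq u : q u ^+ 2 = 1 + u ^+ 2 by rewrite sqr_sqrtr// ltW// oneD_sqr_gt0.
pose F : R -> R := (@id R) * (fun u => (q u)^-1).
have dF (x : R) : is_derive x 1 F (cauchy32 x).
  have d1 : is_derive x 1 (fun x : R => 1 + x ^+ 2) (2 * x).
    have := is_deriveD (is_derive_cst (1 : R) x 1) (is_deriveX 2 (is_derive_id x 1)).
    by rewrite /= expr1 [_%:A]mulr1 add0r; apply.
  have d2 := is_derive1_comp (g := fun x : R => 1 + x ^+ 2) (is_derive1_sqrt (oneD_sqr_gt0 x)) d1.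
  have d3 := is_deriveV (lt0r_neq0 (q0 x)) d2.
  have d4 := is_deriveM (is_derive_id x 1) d3.
  rewrite (_ : cauchy32 x = x *: (- q x ^- 2 *: ((2 * q x)^-1 * (2 * x))) + (q x)^-1 *: 1)//.
  rewrite /cauchy32 /GRing.scale /= -/(q x) -qq.
  have -> : x * (- q x ^- 2 * ((2 * q x)^-1 * (2 * x))) + (q x)^-1 * 1 =
      (q x ^+ 2 - x ^+ 2) / (q x ^+ 2 * q x) by field; rewrite gt_eqF.
  by rewrite [in X in _ = X / _]qq addrK mul1r.
rewrite (@ge0_continuous_FTC2y R cauchy32 F 0 1).
- by rewrite /F /= [X in (_ - X%:E)%E](_ : _ = 0) ?sube0 ?mule1// /GRing.mul /= mul0r.
- by move=> x _; rewrite ltW// cauchy32_gt0.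
- by apply: continuous_subspaceT; exact: continuous_cauchy32.
(* For [x >= 0] the antiderivative is the square root of [1 - (1 + x ^+ 2)^-1], which makes its
   limit at infinity visible. *)
- have -> : (1:R) = Num.sqrt (1 - 0) by rewrite subr0 sqrtr1.
  have cv : (fun u : R => (1 + u ^+ 2)^-1) x @[x --> +oo] --> (0 : R).
    apply/gtr0_cvgV0; first by near=> x; exact: oneD_sqr_gt0.
    exact: (cvg_comp _ _ (@cvgr_expr2 R) (@cvg_addrl R 1)).
  have cv2 : Num.sqrt (1 - (1 + x ^+ 2)^-1) @[x --> +oo] --> Num.sqrt (1 - 0 : R).
    apply: continuous_cvg; first exact: sqrt_continuous.
    by apply: cvgB => //; exact: cvg_cst.
  apply: cvg_trans cv2; apply: near_eq_cvg; near=> x.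
  have x0 : 0 <= x by near: x; exact: nbhs_pinfty_ge.
  rewrite /F -[RHS]/(x * (q x)^-1) -qq.
  have -> : 1 - (q x ^+ 2)^-1 = (x / q x) ^+ 2.
    have -> : 1 - (q x ^+ 2)^-1 = (q x ^+ 2 - 1) / q x ^+ 2 by field; rewrite gt_eqF.
    by rewrite [in X in X / _]qq [1 + _]addrC addrK expr_div_n.
  by rewrite sqrtr_sqr ger0_norm// divr_ge0// ltW.
- by move=> x _; case: (dF x).
- exact/cvg_at_right_filter/(is_derive_continuous dF).
- by move=> x _; rewrite (is_derive_derive1 dF).
Unshelve. all: end_near. Qed.

End Calculus.

(** * The intensity of handovers *)

Section VoidMass.
Context {R : realType} (c : R) (hc : 0 < c).
Notation leb := (@lebesgue_measure R).

Lemma integral_even_half (g : R -> \bar R) : (forall x, 0 <= g x)%E -> measurable_fun setT g ->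
  (forall x, g (- x) = g x) ->
  (\int[leb]_(x in [set x : R | (0 < x)%R]) g x = (2^-1)%:E * \int[leb]_x g x)%E.
Proof.
move=> g0 mg ge; rewrite integral_even// muleA -EFinM mulVf ?mul1e//.
Qed.

(** The factor 1/2 is the Jacobian, obtained one variable at a time: translate [k] to [u = h + k] at
    fixed [h], then rescale [h] to [w = 2 * h - u] at fixed [u]. *)
Lemma integral_rotate (F : R -> R -> \bar R) :
  measurable_fun setT (fun p : R * R => F p.1 p.2) -> (forall u w, 0 <= F u w)%E ->
  (\int[leb]_h \int[leb]_k F (h + k)%R (h - k)%R = \int[leb]_u ((2^-1)%:E * \int[leb]_w F u w))%E.
Proof.
move=> mF F0.
have mF' d (T : measurableType d) (a b : T -> R) : measurable_fun setT a ->
    measurable_fun setT b -> measurable_fun setT (fun z => F (a z) (b z)).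
  by move=> ma mb; exact: (measurableT_comp mF (measurable_fun_pair ma mb)).
transitivity (\int[leb]_h \int[leb]_u F u (2 * h - u)%R)%E.
  apply: eq_integral => h _.
  rewrite -(integral_translate h (fun u => F u (2 * h - u))); last 2 first.
  - by move=> u; exact: F0.
  - by apply: mF' => //; exact: measurable_funB.
  by apply: eq_integral => k _; congr (F _ _); ring.
rewrite (@integral_swap _ (fun h u => F u (2 * h - u))); last 2 first.
- apply: mF'; first exact: measurable_snd.
  apply: measurable_funB; last exact: measurable_snd.
  by apply: measurable_funM => //; exact: measurable_fst.
- by move=> h u; exact: F0.
apply: eq_integral => u _.
by rewrite -(integral_affine 2 (- u) (F u))//; exact: mF'.
Qed.

(** With [c = lam * pi / 4], [u = h + k] and [w = h - k], the probability that the disk of the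
    crossing is empty. *)
Definition void_exp (v u w : R) : R :=
  expR (- (c * ((u ^+ 2 + v ^+ 2) * (w ^+ 2 + v ^+ 2)) / v ^+ 2)).

Lemma void_expC v u w : void_exp v u w = void_exp v w u.
Proof. by rewrite /void_exp [(u ^+ 2 + _) * _]mulrC. Qed.

Lemma void_expN v u w : void_exp v (- u) (- w) = void_exp v u w.
Proof. by rewrite /void_exp !sqrrN. Qed.

Lemma measurable_void_exp d (T : measurableType d) (x y z : T -> R) :
  measurable_fun setT x -> measurable_fun setT y -> measurable_fun setT z ->
  measurable_fun setT (fun t => (void_exp (x t) (y t) (z t))%:E).
Proof.
move=> mx my mz; apply/measurable_EFinP; apply: (measurableT_comp (f := @expR R)).
  exact: measurable_expR.
apply: measurable_funN; apply: measurable_funM.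
  apply: measurable_funM => //.
  by apply: measurable_funM; apply: measurable_funD; exact: measurable_funX.
by apply: (measurableT_comp measurable_invr); exact: measurable_funX.
Qed.

Lemma integral_void_exp (v u : R) : v != 0 ->
  (\int[leb]_w (void_exp v u w)%:E = (Num.sqrt pi * `|v| / (Num.sqrt c * Num.sqrt (u ^+ 2 + v ^+ 2)) *
     expR (- (c * (u ^+ 2 + v ^+ 2))))%:E)%E.
Proof.
move=> v0; have v2 : 0 < v ^+ 2 by rewrite lt0r sqrf_eq0 v0 sqr_ge0.
have uv : 0 < u ^+ 2 + v ^+ 2 by rewrite ltr_wpDl// sqr_ge0.
(* The exponent is minus [c * (u ^+ 2 + v ^+ 2) + b * w ^+ 2]: a Gaussian in [w] of rate [b]. *)
pose b := c * (u ^+ 2 + v ^+ 2) / v ^+ 2.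
have b0 : 0 < b by rewrite divr_gt0// mulr_gt0.
transitivity (\int[leb]_w ((expR (- (c * (u ^+ 2 + v ^+ 2))))%:E * (expR (- (b * w ^+ 2)))%:E))%E.
  apply: eq_integral => w _; rewrite -EFinM -expRD /void_exp; congr (expR _)%:E.
  by rewrite /b; field.
rewrite ge0_integralZl//; last first.
  apply/measurable_EFinP; apply: (measurableT_comp (f := @expR R)).
    exact: measurable_expR.
  by apply: measurable_funN; apply: measurable_funM => //; exact: measurable_funX.
rewrite integral_scaled_gauss// -EFinM mulrC; congr (_ * _)%:E.
rewrite /b sqrtrM ?mulr_ge0 ?ltW// sqrtrV ?sqr_ge0// sqrtr_sqr sqrtrM ?ltW//.
by rewrite invfM invrK mulrA mulrAC.
Qed.

(** What remains in [v] and [p = u / |v|] once [w] is integrated out; for fixed [p] it is a multiple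
    of [|v|] times a Gaussian in [v]. *)
Definition slice_density (v p : R) : R :=
  Num.sqrt pi / (2 * Num.sqrt c) * (Num.sqrt (1 + p ^+ 2))^-1 *
  (`|v| * expR (- (c * (1 + p ^+ 2) * v ^+ 2))).

Lemma slice_density_ge0 v p : 0 <= slice_density v p.
Proof.
by rewrite /slice_density !mulr_ge0// ?expR_ge0// ?invr_ge0 ?sqrtr_ge0// mulr_ge0// sqrtr_ge0.
Qed.

Lemma measurable_slice_density : measurable_fun setT (fun p : R * R => (slice_density p.1 p.2)%:E).
Proof.
have mq : measurable_fun setT (fun p : R * R => 1 + p.2 ^+ 2).
  by apply: measurable_funD => //; apply: measurable_funX; exact: measurable_snd.
apply/measurable_EFinP; apply: measurable_funM.
  apply: measurable_funM => //; apply: (measurableT_comp measurable_invr).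
  apply: (measurableT_comp (f := @Num.sqrt R)) => //.
  by apply: continuous_measurable_fun; exact: sqrt_continuous.
apply: measurable_funM.
  exact: (measurableT_comp (@normr_measurable R setT) measurable_fst).
apply: (measurableT_comp (f := @expR R)); first exact: measurable_expR.
apply: measurable_funN; apply: measurable_funM; first exact: measurable_funM.
by apply: measurable_funX; exact: measurable_fst.
Qed.

(* Put [u = h + k] and [w = h - k], integrate the Gaussian in [w], rescale [u] by [|v|]. *)
Lemma integral_slice (v : R) : v != 0 ->
  (\int[leb]_h \int[leb]_k (void_exp v (h + k) (h - k))%:E = \int[leb]_p (slice_density v p)%:E)%E.
Proof.
move=> v0; have av : 0 < `|v| by rewrite normr_gt0.
have E0 u w : (0 <= (void_exp v u w)%:E)%E by rewrite lee_fin expR_ge0.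
have mE : measurable_fun setT (fun p : R * R => (void_exp v p.1 p.2)%:E).
  exact: measurable_void_exp.
rewrite (@integral_rotate (fun u w => (void_exp v u w)%:E) mE E0).
pose g (u : R) : \bar R := ((2^-1)%:E * \int[leb]_w (void_exp v u w)%:E)%E.
have g0 u : (0 <= g u)%E by rewrite mule_ge0// ?lee_fin// integral_ge0.
have mg : measurable_fun setT g.
  apply: emeasurable_funM => //.
  exact: (@measurable_integral_r _ _ _ (fun u w => (void_exp v u w)%:E)).
have mgs : measurable_fun setT (fun p : R => g (`|v| * p + 0)).
  exact: (measurableT_comp mg (measurable_affine _ _)).
have h := integral_affine `|v| 0 g av g0 mg.
transitivity (`|v|%:E * \int[leb]_p g (`|v| * p + 0)%R)%E.
  by rewrite h muleA -EFinM divff ?gt_eqF// mul1e.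
rewrite -ge0_integralZl//; apply: eq_integral => p _.
rewrite /g integral_void_exp// -!EFinM; congr (_%:E); rewrite addr0.
have -> : (`|v| * p) ^+ 2 + v ^+ 2 = `|v| ^+ 2 * (1 + p ^+ 2).
  by rewrite exprMn -[v ^+ 2]real_normK ?num_real//; ring.
rewrite sqrtrM ?sqr_ge0// sqrtr_sqr normr_id real_normK ?num_real// /slice_density.
have -> : c * (v ^+ 2 * (1 + p ^+ 2)) = c * (1 + p ^+ 2) * v ^+ 2 by ring.
field.
by rewrite !gt_eqF// ?sqrtr_gt0// oneD_sqr_gt0.
Qed.

(** Integrating in [v] first gives [(c * (1 + p ^+ 2))^-1], which with the factor
    [(Num.sqrt (1 + p ^+ 2))^-1] makes a multiple of [cauchy32 p]. *)
Lemma integral_slice_density :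
  (\int[leb]_v \int[leb]_p (slice_density v p)%:E = (Num.sqrt pi / (c * Num.sqrt c))%:E)%E.
Proof.
have S0 v p : (0 <= (slice_density v p)%:E)%E by rewrite lee_fin slice_density_ge0.
have sc : 0 < Num.sqrt c by rewrite sqrtr_gt0.
rewrite (integral_swap measurable_slice_density S0).
pose K := Num.sqrt pi / (2 * c * Num.sqrt c).
have K0 : 0 <= K by rewrite divr_ge0 ?sqrtr_ge0// !mulr_ge0 ?sqrtr_ge0// ltW.
transitivity (\int[leb]_p (K%:E * (cauchy32 p)%:E))%E.
  apply: eq_integral => p _; pose a := Num.sqrt pi / (2 * Num.sqrt c) * (Num.sqrt (1 + p ^+ 2))^-1.
  have a0 : 0 <= a by rewrite mulr_ge0 ?invr_ge0 ?sqrtr_ge0// divr_ge0 ?mulr_ge0 ?sqrtr_ge0.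
  have cp : 0 < c * (1 + p ^+ 2) by rewrite mulr_gt0// oneD_sqr_gt0.
  transitivity (\int[leb]_v (a%:E * (`|v| * expR (- (c * (1 + p ^+ 2) * v ^+ 2)))%:E))%E.
    by apply: eq_integral => v _; rewrite -EFinM.
  rewrite ge0_integralZl//; last exact: measurable_abs_gauss.
  rewrite integral_abs_gauss// -!EFinM; congr (_%:E); rewrite /a /K /cauchy32.
  field.
  by rewrite !gt_eqF// ?sqrtr_gt0 ?oneD_sqr_gt0.
rewrite ge0_integralZl//; last 2 first.
- by apply/measurable_EFinP; exact: measurable_cauchy32.
- by move=> p _; rewrite lee_fin ltW// cauchy32_gt0.
rewrite integral_cauchy32 -EFinM; congr (_%:E); rewrite /K; field.
by rewrite !gt_eqF.
Qed.

(** The integrand is even in each variable, since a sign change of [h] or [k] exchanges [u] and [w]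
    up to sign; the octant carries one eighth of the full integral. *)
Theorem integral_void_octant :
  (\int[leb]_(h in [set x : R | (0 < x)%R]) \int[leb]_(k in [set x : R | (0 < x)%R])
    \int[leb]_(v in [set x : R | (0 < x)%R]) (void_exp v (h + k) (h - k))%:E =
   (Num.sqrt pi / (8 * (c * Num.sqrt c)))%:E)%E.
Proof.
pose V (h k v : R) : \bar R := (void_exp v (h + k) (h - k))%:E.
have V0 h k v : (0 <= V h k v)%E by rewrite lee_fin expR_ge0.
have mV d (T : measurableType d) (x y z : T -> R) : measurable_fun setT x ->
    measurable_fun setT y -> measurable_fun setT z ->
    measurable_fun setT (fun t => V (x t) (y t) (z t)).
  by move=> mx my mz; apply: measurable_void_exp => //;
    [exact: measurable_funD|exact: measurable_funB].
have Vv h k v : V h k (- v) = V h k v by rewrite /V /void_exp sqrrN.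
have Vk h k v : V h (- k) v = V h k v.
  by rewrite /V opprK void_expC.
have Vh h k v : V (- h) k v = V h k v.
  rewrite /V -opprD (_ : - h + k = - (h - k)); last by ring.
  by rewrite void_expN void_expC.
pose V1 h k := (\int[leb]_v V h k v)%E.
have V10 h k : (0 <= V1 h k)%E by apply: integral_ge0.
have mV1 d (T : measurableType d) (x y : T -> R) : measurable_fun setT x ->
    measurable_fun setT y -> measurable_fun setT (fun t => V1 (x t) (y t)).
  move=> mx my; apply: (@measurable_integral_r _ _ _ (fun t v => V (x t) (y t) v)) => //.
  apply: mV; last exact: measurable_snd.
    exact: (measurableT_comp mx measurable_fst).
  exact: (measurableT_comp my measurable_fst).
pose V2 h := (\int[leb]_k V1 h k)%E.
have V20 h : (0 <= V2 h)%E by apply: integral_ge0.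
have mV2 : measurable_fun setT V2.
  by apply: (@measurable_integral_r _ _ _ V1) => //; apply: mV1.
have V1N h k : V1 h (- k) = V1 h k by apply: eq_integral => v _; exact: Vk.
have V2N h : V2 (- h) = V2 h.
  by apply: eq_integral => k _; apply: eq_integral => v _; exact: Vh.
have hv : (0 <= (2^-1 : R)%:E)%E by rewrite lee_fin.
have e1 h k : (\int[leb]_(v in [set x : R | (0 < x)%R]) V h k v = (2^-1)%:E * V1 h k)%E.
  by apply: integral_even_half => //; exact: mV.
have e2 h : (\int[leb]_(k in [set x : R | (0 < x)%R])
    \int[leb]_(v in [set x : R | (0 < x)%R]) V h k v = (4^-1)%:E * V2 h)%E.
  have m1 : measurable_fun setT (fun k => V1 h k) by exact: mV1.
  transitivity (\int[leb]_(k in [set x : R | (0 < x)%R]) ((2^-1)%:E * V1 h k))%E.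
    by apply: eq_integral => k _; exact: e1.
  rewrite integral_even_half; last 3 first.
  - by move=> k; rewrite mule_ge0.
  - by apply: emeasurable_funM.
  - by move=> k; rewrite V1N.
  rewrite ge0_integralZl// muleA -EFinM -invfM; congr (_^-1%:E * _)%E.
  by rewrite -natrM.
have e3 : (\int[leb]_(h in [set x : R | (0 < x)%R]) \int[leb]_(k in [set x : R | (0 < x)%R])
    \int[leb]_(v in [set x : R | (0 < x)%R]) V h k v = (8^-1)%:E * \int[leb]_h V2 h)%E.
  have q0 : (0 <= (4^-1 : R)%:E)%E by rewrite lee_fin.
  transitivity (\int[leb]_(h in [set x : R | (0 < x)%R]) ((4^-1)%:E * V2 h))%E.
    by apply: eq_integral => h _; exact: e2.
  rewrite integral_even_half; last 3 first.
  - by move=> h; rewrite mule_ge0.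
  - by apply: emeasurable_funM.
  - by move=> h; rewrite V2N.
  rewrite ge0_integralZl// muleA -EFinM -invfM; congr (_^-1%:E * _)%E.
  by rewrite -natrM.
rewrite e3.
have -> : (\int[leb]_h V2 h = \int[leb]_v \int[leb]_h \int[leb]_k V h k v)%E.
  transitivity (\int[leb]_h \int[leb]_v \int[leb]_k V h k v)%E.
    apply: eq_integral => h _; apply: (@integral_swap _ (V h)) => //.
    exact: mV.
  apply: (@integral_swap _ (fun h v => \int[leb]_k V h k v)%E); last by move=> h v; exact: integral_ge0.
  apply: (@measurable_integral_r _ _ _ (fun p k => V p.1 k p.2)) => //.
  apply: mV; last exact: (measurableT_comp measurable_snd measurable_fst).
    exact: (measurableT_comp measurable_fst measurable_fst).
  exact: measurable_snd.
have -> : (\int[leb]_v \int[leb]_h \int[leb]_k V h k v =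
    \int[leb]_v \int[leb]_p (slice_density v p)%:E)%E.
  apply: (integral_eq_off_negligible _ _ _ leb (~` [set 0 : R])).
  - exact: measurableC.
  - by rewrite setCK; exact: lebesgue_measure_set1.
  - by move=> v; apply: integral_ge0 => h _; exact: integral_ge0.
  - by move=> v; apply: integral_ge0 => p _; rewrite lee_fin slice_density_ge0.
  by move=> v /eqP v0; exact: integral_slice.
rewrite integral_slice_density -EFinM; congr (_%:E); field.
by rewrite !gt_eqF// sqrtr_gt0.
Qed.

End VoidMass.

Section Intensity.
Context {R : realType} (lam : R) (hlam : 0 < lam).
Context (P : probability (Cfg R) R) (hP : is_poisson_law lam P).
Notation leb := (@lebesgue_measure R).

Lemma hhat2E (h k v : R) : v != 0 ->
  hhat2 0 h (- v) k = ((h + k) ^+ 2 + v ^+ 2) * ((h - k) ^+ 2 + v ^+ 2) / (4 * v ^+ 2).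
Proof. by move=> v0; rewrite /hhat2; field; rewrite ?opprK ?add0r v0. Qed.

(* [intens lam (Udisk s r) = lam * pi * r ^+ 2], and [r ^+ 2] factors by [hhat2E]. *)
Lemma pair_mass_cst1 (h k v : R) : 0 < v ->
  pair_mass P (cst 1%E) (0, h) (- v, k) =
  (void_exp (lam * pi / 4) v (h + k) (h - k))%:E.
Proof.
move=> v0; have vn : v != 0 by rewrite gt_eqF.
have v2 : 0 < v ^+ 2 by rewrite exprn_gt0.
set r := pairr (0, h) (- v, k); set s := pairs (0, h) (- v, k).
have rE : r ^+ 2 = ((h + k) ^+ 2 + v ^+ 2) * ((h - k) ^+ 2 + v ^+ 2) / (4 * v ^+ 2).
  by rewrite /r sqr_pairr hhat2E.
have r0 : 0 < r ^+ 2.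
  by rewrite rE divr_gt0 ?mulr_gt0// ltr_wpDl// sqr_ge0.
have mU : measurable (Udisk s r).
  apply: measurableI; first exact: measurable_ltr_set.
  apply: measurable_ltr_set => //; apply: measurable_funD; last exact: measurable_funX.
  by apply: measurable_funX; apply: measurable_funB.
have iU : intens lam (Udisk s r) = (2 * lam * (r ^+ 2 * (pi / 2)))%:E.
  rewrite /intens (_ : Udisk s r `&` @Hplus R = Udisk s r) ?leb2_Udisk//.
  by apply/setIidPl => p [].
transitivity (P [set w : Cfg R | w `&` Udisk s r = set0]).
  transitivity (\int[P]_w (\1_[set w : Cfg R | w `&` Udisk s r = set0] w)%:E)%E.
    by apply: eq_integral => w _; rewrite /void_weight mule1.
  by rewrite integral_indic ?setIT//; exact: measurable_void.
rewrite (prob_void _ _ hP)//; last by rewrite iU ltry.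
rewrite iU /= rE /void_exp; congr (expR _)%:E; field.
by rewrite vn.
Qed.

(** For [c = lam * pi / 4] the denominator [8 * (c * Num.sqrt c)] is (lam pi)^(3/2), and (2 lam)^2
    sqrt(pi) divided by it gives the value. *)
Lemma intensity_handover : pp_intensity P (@handover R) = (4 * Num.sqrt lam / pi)%:E.
Proof.
have p0 : 0 < (pi : R) by exact: pi_gt0.
rewrite /pp_intensity (numerator_formula hlam hP (f := cst 1%E))//.
have -> : (\int[leb]_(h in [set x : R | (0 < x)%R]) \int[leb]_(k in [set x : R | (0 < x)%R])
   \int[leb]_(v in [set x : R | (0 < x)%R]) pair_mass P (cst 1%E) (0%R, h) ((- v)%R, k) =
  \int[leb]_(h in [set x : R | (0 < x)%R]) \int[leb]_(k in [set x : R | (0 < x)%R])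
   \int[leb]_(v in [set x : R | (0 < x)%R]) (void_exp (lam * pi / 4) v (h + k) (h - k))%:E)%E.
  apply: eq_integral => h _; apply: eq_integral => k _; apply: eq_integral => v.
  by rewrite inE => v0; exact: pair_mass_cst1.
have c0 : 0 < lam * pi / 4 by rewrite divr_gt0// mulr_gt0.
rewrite integral_void_octant// -EFinM; congr (_%:E).
have -> : Num.sqrt (lam * pi / 4) = Num.sqrt lam * Num.sqrt pi / 2.
  rewrite sqrtrM ?mulr_ge0 ?ltW// sqrtrV// sqrtrM ?ltW//; congr (_ / _).
  by rewrite (_ : 4 = 2 ^+ 2) ?sqrtr_sqr ?ger0_norm// expr2 -natrM.
have sl : Num.sqrt lam != 0 by rewrite gt_eqF// sqrtr_gt0.
have sp : Num.sqrt (pi : R) != 0 by rewrite gt_eqF// sqrtr_gt0.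
have -> : lam = Num.sqrt lam ^+ 2 by rewrite sqr_sqrtr// ltW.
rewrite [Num.sqrt (_ ^+ 2)]sqrtr_sqr ger0_norm ?sqrtr_ge0//.
move: sp p0 {c0}; generalize (pi : R) => q sq q0.
by field; rewrite sl sq gt_eqF.
Qed.

Lemma powR_3_2 : lam `^ (3 / 2) = lam * Num.sqrt lam.
Proof.
have -> : 3 / 2 = 1 + 2^-1 :> R by field.
rewrite powRD; last by rewrite gt_eqF// implybT.
by rewrite powRr1 ?ltW// powR12_sqrt// ltW.
Qed.

End Intensity.

Unset Implicit Arguments.
Set Strict Implicit.

(** The intensity being finite and positive, the [fine] and the inverse in [palmE] express a genuine
    normalisation. *)
Theorem theorem5p4 (R : realType) (lam : R) (hlam : 0 < lam)
  (P : probability (Cfg R) R) (hP : is_poisson_law lam P)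
  (f : Cfg R -> \bar R) (f_ge0 : forall w, (0 <= f w)%E)
  (f_meas : measurable_fun setT f) :
  palmE P (@handover R) f =
  ((pi * powR lam (3 / 2))%:E *
   \int[lebesgue_measure]_(h in [set x : R | (0 < x)%R])
    \int[lebesgue_measure]_(h' in [set x : R | (0 < x)%R])
     \int[lebesgue_measure]_(t' in [set x : R | (0 < x)%R])
      \int[P]_w
        ((\1_[set w' : Cfg R | w' `&` Udisk (shat 0%R h (- t')%R h') (hhat 0%R h (- t')%R h') = set0] w)%:E
         * f (theta (shat 0%R h (- t')%R h') (w `|` [set (0%R, (h:R))] `|` [set ((- t')%R, (h':R))]))))%E.
Proof.
have p0 : 0 < (pi : R) by exact: pi_gt0.
have sl : 0 < Num.sqrt lam by rewrite sqrtr_gt0.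
rewrite /palmE (intensity_handover hlam hP) (numerator_formula hlam hP f_ge0 f_meas).
rewrite muleAC -EFinM; congr (_%:E * _)%E.
(* Writing [lam] as the square of [Num.sqrt lam] turns the comparison of constants into a rational
   identity. *)
rewrite powR_3_2//= -[in LHS](sqr_sqrtr (ltW hlam)) -[X in pi * (X * _)](sqr_sqrtr (ltW hlam)).
rewrite [Num.sqrt (_ ^+ 2)]sqrtr_sqr ger0_norm ?sqrtr_ge0//.
move: p0; generalize (pi : R) => q q0.
by field; rewrite !gt_eqF.
Qed.
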